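(* There is an absolute constant $c>0$ such that the following holds. Let $A\in\mathbb{R}^{n\times n}$ be symmetric positive definite, $b\in\mathbb{R}^n$, $M\in\mathbb{R}^{n\times n}$ symmetric positive definite, and let $\kappa_M$ be the condition number of $M^{-1/2}AM^{-1/2}$. Let $\epsilon\in(0,1)$, and suppose $\mathsf{SolveM}$ is a procedure such that for every input $r\in\mathbb{R}^n$, $\|\mathsf{SolveM}(r)-M^{-1}r\|_M\le\epsilon_0\|M^{-1}r\|_M$, where $\epsilon_0\le(\epsilon/(\kappa_Mn))^c$. Then the Inexact Preconditioned Lanczos procedure (described in the context), run in exact arithmetic with this $\mathsf{SolveM}$ for $t=O(\sqrt{\kappa_M}\log(\kappa_M/\epsilon))$ iterations, outputs $x_t$ with $$\|x_t-A^{-1}b\|_A\le\epsilon\,\|A^{-1}b\|_A.$$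
   Context: Inexact Preconditioned Lanczos (input $A$, $b$, $\mathsf{SolveM}$, $t$): set $\bar w_0=\mathsf{SolveM}(b)$, $z'=\sqrt{\langle b,\bar w_0\rangle}$, $\underline{q}_0=0$, $\bar q_1=\bar w_0/z'$, $\underline{q}_1=b/z'$, $\beta'_1=0$. For $i=1,\dots,t$: $\underline{u}_i=A\bar q_i-\beta'_i\underline{q}_{i-1}$; $\alpha'_i=\langle\underline{u}_i,\bar q_i\rangle$; $\underline{w}_i=\underline{u}_i-\alpha'_i\underline{q}_i$; $\bar w_i=\mathsf{SolveM}(\underline{w}_i)$; $\beta'_{i+1}=\langle\underline{w}_i,\bar w_i\rangle^{1/2}$; if $\beta'_{i+1}=0$ stop the loop; otherwise $\underline{q}_{i+1}=\underline{w}_i/\beta'_{i+1}$, $\bar q_{i+1}=\bar w_i/\beta'_{i+1}$. Let $T'$ be the symmetric tridiagonal matrix with diagonal $\alpha'_1,\dots,\alpha'_t$ and off-diagonal entries $\beta'_2,\dots,\beta'_t$ (with $t$ replaced by the number of completed iterations if the loop stopped early), and $\bar Q=[\bar q_1,\dots,\bar q_t]$. Output $x_t=z'\,\bar QT'^{-1}e_1$, where $e_1$ is the first standard basis vector. Here $\|x\|_B=\sqrt{x^\top Bx}$. *)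

(* Defs.v *)
From HB Require Import structures.
From mathcomp Require Import all_boot all_order all_algebra.
From mathcomp Require Import all_classical all_reals all_analysis.
From mathcomp Require Import Rstruct Rstruct_topology.
Set Implicit Arguments. Unset Strict Implicit. Unset Printing Implicit Defensive.
Import Order.TTheory GRing.Theory Num.Theory.
Local Open Scope ring_scope.
Local Open Scope classical_set_scope.

Section Defs.
Variable R : realType.
Variable n : nat.

Definition dot (x y : 'cV[R]_n) : R := (x^T *m y) 0 0.

Definition spd (B : 'M[R]_n) : Prop :=
  B^T = B /\ forall x : 'cV[R]_n, x != 0 -> 0 < dot x (B *m x).

Definition Bnorm (B : 'M[R]_n) (x : 'cV[R]_n) : R := Num.sqrt (dot x (B *m x)).

Definition enorm (x : 'cV[R]_n) : R := Num.sqrt (dot x x).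
Definition opnorm (B : 'M[R]_n) : R :=
  sup [set enorm (B *m x) | x in [set x : 'cV[R]_n | enorm x = 1]].

Definition cond (B : 'M[R]_n) : R := opnorm B * opnorm (invmx B).

Record lstate := LState {
  ls_alpha : seq R;
  ls_beta : seq R;             (* beta'_2, ..., beta'_(i+1) (nonzero ones) *)
  ls_qbar : seq 'cV[R]_n;
  ls_qu_prev : 'cV[R]_n;
  ls_qu : 'cV[R]_n;
  ls_qb : 'cV[R]_n;
  ls_b : R;
  ls_stop : bool }.

Variables (A : 'M[R]_n) (SolveM : 'cV[R]_n -> 'cV[R]_n).

Definition lanczos_step (st : lstate) : lstate :=
  if ls_stop st then st else
  let u := A *m ls_qb st - ls_b st *: ls_qu_prev st in
  let a := dot u (ls_qb st) in
  let w := u - a *: ls_qu st in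
  let wb := SolveM w in
  let be := Num.sqrt (dot w wb) in
  if be == 0 then
    LState (rcons (ls_alpha st) a) (ls_beta st) (rcons (ls_qbar st) (ls_qb st))
           (ls_qu_prev st) (ls_qu st) (ls_qb st) (ls_b st) true
  else
    LState (rcons (ls_alpha st) a) (rcons (ls_beta st) be)
           (rcons (ls_qbar st) (ls_qb st))
           (ls_qu st) (be^-1 *: w) (be^-1 *: wb) be false.

Fixpoint lanczos_iter (k : nat) (st : lstate) : lstate :=
  match k with
  | 0 => st
  | k'.+1 => lanczos_step (lanczos_iter k' st)
  end.

Definition ipl (b : 'cV[R]_n) (t : nat) : 'cV[R]_n :=
  let w0 := SolveM b in
  let z := Num.sqrt (dot b w0) in
  let st0 := LState [::] [::] [::] 0 (z^-1 *: b) (z^-1 *: w0) 0 false in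
  let st := lanczos_iter t st0 in
  let al := ls_alpha st in
  let be := ls_beta st in
  let qs := ls_qbar st in
  let k := size al in
  let T : 'M[R]_k := \matrix_(i < k, j < k)
      (if i == j then al`_i
       else if (j == i.+1 :> nat) || (i == j.+1 :> nat) then be`_(minn i j)
       else 0) in
  let y : 'cV[R]_k := invmx T *m (\col_(i < k) (i == 0 :> nat)%:R) in
  z *: \sum_(j < k) y j 0 *: qs`_j.

End Defs.

(* Main.v *)
(** Put [H = M^-1/2 A M^-1/2], [p_i = M^-1/2 qu_i] and [q_i = M^1/2 qb_i].  Only the
identity [p_i = q_i] is perturbed by the inexact solves: the relation
[H Q = P T + w_t e_t^T] with [T] exactly tridiagonal, the normalisation
[<p_i, q_i> = 1] and [<q_i, w_i> = 0] hold exactly.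

Orthogonality is lost globally, so the spectrum of [T] is controlled through the
pivots of [T - mu I = L D L^T].  The conjugate directions attached to this
factorisation satisfy [<nu_i, (H - mu) nu_i> = d_i / sigma_i^2] up to an error [ze_i]
that obeys a two-term recurrence with small increments.  As long as the errors are
small, the energies [<r_i, (H - mu)^-1 r_i>] decrease, which bounds the ratios
[sigma_i / sigma_j] by the condition number and hence keeps the errors small at the
next step.  So [d_i > 0], i.e. [T > mu I] with [mu] half the least eigenvalue of [H];
and a positive definite tridiagonal matrix is at most twice its diagonal.

The residual of the output is [y_t w_t] with [y = T_t^-1 e_1], and [beta_(t+1) y_t] is
the residual of exact Galerkin projection for the [(t+1) x (t+1)] matrix [T], which
Chebyshev polynomials bound, without any spectral theorem, by means of the Pell
identity [T_k^2 + (1 - x^2) U_(k-1)^2 = 1].  When [kappa / eps] is close to 1 this bound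
is vacuous; there the first step alone reduces the energy enough. *)
Require Import Defs.
From HB Require Import structures.
From Stdlib Require Import Rdefinitions.
From mathcomp Require Import all_boot all_order all_algebra.
From mathcomp Require Import all_classical all_reals all_analysis.
From mathcomp Require Import Rstruct Rstruct_topology.
From mathcomp Require Import ring lra zify.
Set Implicit Arguments. Unset Strict Implicit. Unset Printing Implicit Defensive.
Import Order.TTheory GRing.Theory Num.Theory.
Local Open Scope ring_scope.

(** * The Euclidean inner product and coercive matrices *)

Section Dot.
Context {R : realType} {n : nat}.
Implicit Types (x y z : 'cV[R]_n) (B : 'M[R]_n) (k : R).

Lemma dotE x y : dot x y = \sum_i x i 0 * y i 0.
Proof. by rewrite /dot mxE; apply: eq_bigr => i _; rewrite mxE. Qed.

Lemma dotC x y : dot x y = dot y x.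
Proof. by rewrite !dotE; apply: eq_bigr => i _; rewrite mulrC. Qed.

Lemma dotDr x y z : dot x (y + z) = dot x y + dot x z.
Proof. by rewrite /dot mulmxDr mxE. Qed.

Lemma dotZr k x y : dot x (k *: y) = k * dot x y.
Proof. by rewrite /dot -scalemxAr mxE. Qed.

Lemma dotDl x y z : dot (y + z) x = dot y x + dot z x.
Proof. by rewrite dotC dotDr !(dotC x). Qed.

Lemma dotZl k x y : dot (k *: x) y = k * dot x y.
Proof. by rewrite dotC dotZr dotC. Qed.

Lemma dotNr x y : dot x (- y) = - dot x y.
Proof. by rewrite -scaleN1r dotZr mulN1r. Qed.

Lemma dotNl x y : dot (- x) y = - dot x y.
Proof. by rewrite dotC dotNr dotC. Qed.

Lemma dot0r x : dot x 0 = 0.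
Proof. by rewrite /dot mulmx0 mxE. Qed.

Lemma dot0l x : dot 0 x = 0.
Proof. by rewrite dotC dot0r. Qed.

Definition dot_lin := (dotDl, dotDr, dotZl, dotZr, dotNl, dotNr).

Lemma dot_ge0 x : 0 <= dot x x.
Proof. by rewrite dotE sumr_ge0 // => i _; rewrite -expr2 sqr_ge0. Qed.

Lemma dot_eq0 x : (dot x x == 0) = (x == 0).
Proof.
apply/eqP/eqP => [|->]; last by rewrite dot0r.
rewrite dotE => /eqP; rewrite psumr_eq0; last by move=> i _; rewrite -expr2 sqr_ge0.
move=> /allP h; apply/matrixP => i j; rewrite ord1 mxE.
by have := h i (mem_index_enum _); rewrite /= -expr2 sqrf_eq0 => /eqP.
Qed.

Lemma dot_gt0 x : (0 < dot x x) = (x != 0).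
Proof. by rewrite lt_def dot_ge0 dot_eq0 andbT. Qed.

Lemma dot_mulmxl B x y : dot (B *m x) y = dot x (B^T *m y).
Proof. by rewrite /dot trmx_mul mulmxA. Qed.

Lemma dot_sym B x y : B^T = B -> dot (B *m x) y = dot x (B *m y).
Proof. by move=> Bs; rewrite dot_mulmxl Bs. Qed.

(** A nonnegative quadratic in [k], evaluated at its minimiser. As the form is only semidefinite,
    [b = 0] is a separate case. *)
Lemma form_cauchy B x y : B^T = B -> (forall z, 0 <= dot z (B *m z)) ->
  dot x (B *m y) ^+ 2 <= dot x (B *m x) * dot y (B *m y).
Proof.
move=> Bs Bp; set a := dot x (B *m x); set b := dot y (B *m y); set c := dot x _.
have cE : dot y (B *m x) = c by rewrite /c -dot_sym // dotC.
have a0 : 0 <= a by exact: Bp.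
have b0 : 0 <= b by exact: Bp.
have key k : 0 <= a + 2 * k * c + k ^+ 2 * b.
  have := Bp (x + k *: y).
  rewrite mulmxDr -scalemxAr !dot_lin cE -/a -/b -/c => h.
  by rewrite (_ : _ + _ = a + k * c + k * (c + k * b)) //; ring.
have [b00|bn0] := eqVneq b 0.
  have [-> | cn0] := eqVneq c 0; first by rewrite expr0n /= mulr_ge0.
  (* With [b = 0] the quadratic is affine, and this [k] gives it the value -1. *)
  have := key (- (a + 1) / (2 * c)); rewrite b00 mulr0 addr0.
  rewrite (_ : _ + _ = -1); last by field.
  by rewrite lerNr oppr0 ler10.
have bp : 0 < b by rewrite lt_def bn0.
have := key (- c / b).
rewrite (_ : _ + _ = (a * b - c ^+ 2) / b); last by field.
by rewrite pmulr_lge0 ?invr_gt0 // subr_ge0.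
Qed.

Lemma dot_cauchy x y : dot x y ^+ 2 <= dot x x * dot y y.
Proof.
have := @form_cauchy 1%:M x y; rewrite !mul1mx; apply; first by rewrite trmx1.
by move=> z; rewrite mul1mx dot_ge0.
Qed.

Lemma enorm_ge0 x : 0 <= enorm x. Proof. exact: sqrtr_ge0. Qed.

Lemma enorm_sqr x : enorm x ^+ 2 = dot x x.
Proof. by rewrite sqr_sqrtr // dot_ge0. Qed.

Lemma enorm0 : enorm (0 : 'cV[R]_n) = 0.
Proof. by rewrite /enorm dot0r sqrtr0. Qed.

Lemma enorm_eq0 x : (enorm x == 0) = (x == 0).
Proof. by rewrite -dot_eq0 -enorm_sqr sqrf_eq0. Qed.

Lemma enormZ k x : enorm (k *: x) = `|k| * enorm x.
Proof.
by rewrite /enorm dotZl dotZr mulrA -expr2 sqrtrM ?sqr_ge0 // sqrtr_sqr.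
Qed.

Lemma dot_le x y : `|dot x y| <= enorm x * enorm y.
Proof.
rewrite -ler_sqr ?nnegrE ?mulr_ge0 ?enorm_ge0 // real_normK ?num_real //.
by rewrite exprMn !enorm_sqr dot_cauchy.
Qed.

Lemma enormD x y : enorm (x + y) <= enorm x + enorm y.
Proof.
rewrite -ler_sqr ?nnegrE ?addr_ge0 ?enorm_ge0 // enorm_sqr sqrrD !enorm_sqr.
rewrite !dot_lin (dotC y x).
have := le_trans (ler_norm _) (dot_le x y); lra.
Qed.

Lemma enorm_sum (F : nat -> 'cV[R]_n) N :
  enorm (\sum_(i < N) F i) <= \sum_(i < N) enorm (F i).
Proof.
elim: N => [|N ih]; first by rewrite !big_ord0 enorm0.
by rewrite !big_ord_recr /= (le_trans (enormD _ _)) // lerD2r.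
Qed.

Lemma posdef_unit B : (forall x, x != 0 -> 0 < dot x (B *m x)) -> B \in unitmx.
Proof.
move=> Bp; rewrite -unitmx_tr -row_free_unit -kermx_eq0; apply/eqP/row_matrixP => i.
rewrite row0; set v := row i _.
have : v *m B^T = 0 by rewrite /v -row_mul mulmx_ker row0.
move/(congr1 trmx); rewrite trmx_mul trmxK trmx0 => Bv.
apply/eqP; apply: contraT => v0; have v0' : v^T != 0.
  by apply: contra v0 => /eqP /(congr1 trmx); rewrite trmxK trmx0 => ->.
by have := Bp _ v0'; rewrite Bv dot0r ltxx.
Qed.

Lemma spd_unit B : spd B -> B \in unitmx.
Proof. by case=> _; apply: posdef_unit. Qed.

Lemma spd_ge0 B : spd B -> forall x, 0 <= dot x (B *m x).
Proof.
case=> _ Bp x; have [->|x0] := eqVneq x 0; first by rewrite mulmx0 dot0r.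
exact/ltW/Bp.
Qed.

End Dot.

(** * Quadratic form of the inverse of a coercive matrix *)

Section Inverse.
Context {R : realType} {n : nat} {B : 'M[R]_n} {m L : R}.
Hypothesis B_sym : B^T = B.
Hypothesis m_gt0 : 0 < m.
Hypothesis B_lo : forall x, m * dot x x <= dot x (B *m x).
Implicit Types x y : 'cV[R]_n.

Lemma coercive_unit : B \in unitmx.
Proof.
apply: posdef_unit => x x0; apply: lt_le_trans (B_lo x).
by rewrite mulr_gt0 // dot_gt0.
Qed.

Lemma inv_sym : (invmx B)^T = invmx B.
Proof. by rewrite trmx_inv B_sym. Qed.

Lemma mulKB x : B *m (invmx B *m x) = x.
Proof. by rewrite mulmxA mulmxV ?coercive_unit // mul1mx. Qed.

Lemma mulBK x : invmx B *m (B *m x) = x.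
Proof. by rewrite mulmxA mulVmx ?coercive_unit // mul1mx. Qed.

Lemma inv_form_ge0 x : 0 <= dot x (invmx B *m x).
Proof.
rewrite -{1}(mulKB x) dotC; apply: le_trans (B_lo _).
by rewrite mulr_ge0 ?dot_ge0 // ltW.
Qed.

Lemma inv_enorm x : enorm (invmx B *m x) <= enorm x / m.
Proof.
rewrite ler_pdivlMr //; set y := invmx B *m x.
have := B_lo y; rewrite mulKB -enorm_sqr => h1.
have h2 := le_trans h1 (le_trans (ler_norm _) (dot_le y x)).
have := enorm_ge0 y; rewrite le_eqVlt => /orP[/eqP<-|y0].
  by rewrite mul0r enorm_ge0.
rewrite -(ler_pM2l y0); apply: le_trans h2; rewrite le_eqVlt; apply/orP; left.
by apply/eqP; ring.
Qed.

Lemma inv_form_up x : dot x (invmx B *m x) <= dot x x / m.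
Proof.
apply: le_trans (ler_norm _) _; apply: le_trans (dot_le _ _) _.
rewrite -enorm_sqr expr2 -mulrA ler_wpM2l ?enorm_ge0 //; exact: inv_enorm.
Qed.

(** Cauchy-Schwarz in the form of [B], for [x] and [B^-1 x], gives [<x,x>^2 <= <x,Bx> <x,B^-1 x>];
    one factor [<x,x>] then cancels. *)
Lemma inv_form_lo x : (forall x, dot x (B *m x) <= L * dot x x) ->
  dot x x <= L * dot x (invmx B *m x).
Proof.
move=> B_up.
have Bp z : 0 <= dot z (B *m z).
  by apply: le_trans (B_lo z); rewrite mulr_ge0 ?dot_ge0 // ltW.
have := @form_cauchy _ _ B x (invmx B *m x) B_sym Bp.
rewrite mulKB (dotC _ x) => h.
have := dot_ge0 x; rewrite le_eqVlt => /orP[/eqP x0|x0].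
  have /eqP -> : x == 0 by rewrite -dot_eq0 -x0.
  by rewrite !dot0l mulr0.
rewrite -(ler_pM2l x0) -expr2 (le_trans h) // mulrA (mulrC _ L) ler_wpM2r ?B_up //.
exact: inv_form_ge0.
Qed.

End Inverse.

(** * Operator norm and bounds on quadratic forms *)

Section OpNorm.
Context {R : realType} {n : nat}.
Implicit Types (B : 'M[R]_n) (x : 'cV[R]_n).

(** Cauchy-Schwarz row by row. It shows that the set whose supremum defines [opnorm] is bounded
    above. *)
Lemma mulmx_bounded B : exists c, forall x, enorm (B *m x) <= c * enorm x.
Proof.
pose r i := (row i B)^T.
exists (Num.sqrt (\sum_i dot (r i) (r i))) => x.
rewrite -ler_sqr ?nnegrE ?mulr_ge0 ?sqrtr_ge0 ?enorm_ge0 //.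
rewrite exprMn !enorm_sqr sqr_sqrtr ?sumr_ge0 // => [|i _]; last exact: dot_ge0.
rewrite {1}dotE mulr_suml; apply: ler_sum => i _.
have -> : (B *m x) i 0 = dot (r i) x.
  by rewrite dotE mxE; apply: eq_bigr => j _; rewrite !mxE.
by rewrite -expr2 dot_cauchy.
Qed.

Lemma opnorm_le B x : enorm (B *m x) <= opnorm B * enorm x.
Proof.
have [->|x0] := eqVneq x 0; first by rewrite mulmx0 enorm0 mulr0.
have nx : 0 < enorm x by rewrite lt_def enorm_eq0 x0 enorm_ge0.
have -> : enorm (B *m x) = enorm (B *m ((enorm x)^-1 *: x)) * enorm x.
  by rewrite -scalemxAr enormZ normfV ger0_norm ?enorm_ge0 // mulrAC mulVf ?mul1r // gt_eqF.
rewrite ler_wpM2r ?enorm_ge0 //; apply: ub_le_sup.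
  have [c hc] := mulmx_bounded B; exists c => _ [y /= y1 <-].
  by rewrite (le_trans (hc y)) // y1 mulr1.
exists ((enorm x)^-1 *: x) => //=.
by rewrite enormZ normfV ger0_norm ?enorm_ge0 // mulVf // gt_eqF.
Qed.

Lemma opnorm_form_up B x : dot x (B *m x) <= opnorm B * dot x x.
Proof.
apply: le_trans (ler_norm _) _; apply: le_trans (dot_le _ _) _.
by rewrite -enorm_sqr expr2 mulrCA ler_wpM2l ?enorm_ge0 // opnorm_le.
Qed.

(** Makes [1 / opnorm (invmx B)] a coercivity constant without eigenvalues: Cauchy-Schwarz as in
    [inv_form_lo], with [<x, B^-1 x>] bounded by the operator norm. *)
Lemma opnorm_form_lo B x : B^T = B -> B \in unitmx ->
  (forall x, 0 <= dot x (B *m x)) ->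
  dot x x <= opnorm (invmx B) * dot x (B *m x).
Proof.
move=> Bs Bu Bp.
have := form_cauchy x (invmx B *m x) Bs Bp.
rewrite mulmxA mulmxV // mul1mx => h.
have h2 := opnorm_form_up (invmx B) x.
have := dot_ge0 x; rewrite le_eqVlt => /orP[/eqP x0|x0].
  have /eqP -> : x == 0 by rewrite -dot_eq0 -x0.
  by rewrite !dot0l mulr0.
rewrite -(ler_pM2l x0) -expr2 (le_trans h) //.
rewrite (dotC (invmx B *m x)) (le_trans (ler_wpM2l (Bp x) h2)) //.
by rewrite mulrCA mulrA mulrC.
Qed.

End OpNorm.

(** * Perturbed Lanczos recurrences *)

Section Pivots.
Context {R : realType}.
Variables (al be : nat -> R).

Fixpoint pivot i : R :=
  if i is j.+1 then al j.+1 - be j.+1 ^+ 2 / pivot j else al 0%N.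

(** Entry [i] of [L^-1 e_1], where [L] is the unit lower bidiagonal factor of the tridiagonal
    matrix, with subdiagonal entries [be j.+1 / pivot j]. *)
Fixpoint scale i : R :=
  if i is j.+1 then - (be j.+1 / pivot j) * scale j else 1.

Lemma scale_neq0 i : (forall j, (j < i)%N -> pivot j != 0 /\ be j.+1 != 0) ->
  scale i != 0.
Proof.
elim: i => [|i ih] h /=; first exact: oner_neq0.
have [h1 h2] := h i (leqnn _).
rewrite mulf_neq0 ?oppr_eq0 ?mulf_neq0 ?invr_neq0 //.
by apply: ih => j ji; apply: h; apply: ltnW.
Qed.

End Pivots.

Section Run.
Context {R : realType} {n : nat}.
Variables (B : 'M[R]_n) (mu m La dl : R) (N : nat).
Variables (p q w : nat -> 'cV[R]_n) (al be : nat -> R).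

Hypothesis B_sym : B^T = B.
Hypothesis m_gt0 : 0 < m.
Hypothesis m_le_La : m <= La.
Hypothesis B_lo : forall x, m * dot x x <= dot x (B *m x).
Hypothesis B_up : forall x, dot x (B *m x) <= La * dot x x.
Hypothesis mu_ge0 : 0 <= mu.
Hypothesis mu_le : mu <= m.
Hypothesis N_gt0 : (0 < N)%N.
Hypothesis dl_ge0 : 0 <= dl.

Let f i := q i - p i.
Variable rho : R.
Hypothesis rhoE : rho = 2 * La / m.

Hypothesis dl_small : 2048 * N%:R ^+ 3 * rho ^+ 4 * dl <= 1.
Hypothesis pq1 : forall i, (i < N)%N -> dot (p i) (q i) = 1.
Hypothesis f_small : forall i, (i < N)%N -> enorm (f i) <= dl * enorm (p i).
(** [B] stands for [H - mu I] and [al] for the shifted diagonal. Subtracting [mu q_i] on the left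
    but [mu p_i] on the right leaves the defect [mu f_i]. At [i = 0] the meaningless [p 0.-1] is
    multiplied by [be 0 = 0]. *)
Hypothesis three_term : forall i, (i < N)%N ->
  B *m q i + mu *: f i = be i *: p i.-1 + al i *: p i + w i.
Hypothesis be0 : be 0%N = 0.
Hypothesis w_next : forall i, (i.+1 < N)%N -> w i = be i.+1 *: p i.+1 /\ be i.+1 != 0.
Hypothesis qw0 : forall i, (i < N)%N -> dot (q i) (w i) = 0.

Notation d := (pivot al be).
Notation sg := (scale al be).
Let K := invmx B.

Let La_gt0 : 0 < La. Proof. exact: lt_le_trans m_le_La. Qed.

Let rho_ge2 : 2 <= rho.
Proof. by rewrite rhoE -mulrA ler_peMr // ler_pdivlMr // mul1r. Qed.

Let N_ge1 : 1 <= N%:R :> R. Proof. by rewrite ler1n. Qed.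

(** Unit of accumulated error: [ze_iota] bounds the scaled [ze i] by [iota * m], and each step moves
    [ppi] by at most [16 * iota]. *)
Let iota := 16 * N%:R ^+ 2 * rho ^+ 4 * dl.

Let iota_small : N%:R * iota <= 128^-1.
Proof.
rewrite -(ler_pM2l (_ : 0 < 128 :> R)) // divff ?gt_eqF //.
apply: le_trans dl_small; rewrite le_eqVlt; apply/orP; left; apply/eqP.
by rewrite /iota; ring.
Qed.

Let iota_ge0 : 0 <= iota.
Proof. have := le_trans (ler0n R 2) rho_ge2 => r0.
rewrite /iota.
by do ?[exact: r0 | exact: ler0n | exact: dl_ge0 | apply: mulr_ge0 | apply: exprn_ge0]. Qed.

Let dl_le : dl <= 1000^-1.
Proof.
have h1 : 1 <= N%:R ^+ 2 :> R by rewrite exprn_ege1.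
have h2 : 16 <= rho ^+ 4.
  by rewrite (_ : 16 = 2 ^+ 4); [rewrite lerXn2r ?nnegrE // (le_trans _ rho_ge2) | ring].
have h3 : 256 * dl <= iota.
  rewrite /iota ler_wpM2r // (_ : 256 = 16 * 1 * 16); last by ring.
  by apply: ler_pM => //; apply: ler_pM.
have h4 : iota <= N%:R * iota by rewrite ler_peMl.
have := iota_small; lra.
Qed.

(** * A priori bounds on the vectors and coefficients *)

Lemma p_norm i : (i < N)%N -> 2^-1 <= dot (p i) (p i) <= 121/100.
Proof.
move=> iN; have := pq1 iN; rewrite -(subrK (p i) (q i)) dot_lin -/(f i).
have h1 := dot_le (p i) (f i); have h2 := f_small iN.
have h3 : enorm (p i) * enorm (f i) <= dl * dot (p i) (p i).
  by rewrite -enorm_sqr expr2 mulrCA ler_wpM2l ?enorm_ge0.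
have h4 : dl * dot (p i) (p i) <= 1000^-1 * dot (p i) (p i).
  by rewrite ler_wpM2r ?dot_ge0.
move: h1; rewrite ler_norml => /andP[h5 h6] h7; lra.
Qed.

Lemma p_enorm i : (i < N)%N -> enorm (p i) <= 11/10.
Proof.
move=> /p_norm /andP[_ h]; rewrite -ler_sqr ?nnegrE ?enorm_ge0 //.
by rewrite enorm_sqr (le_trans h) //; lra.
Qed.

Lemma f_enorm i : (i < N)%N -> enorm (f i) <= 11/10 * dl.
Proof.
move=> iN; apply: le_trans (f_small iN) _; rewrite mulrC.
by rewrite ler_wpM2r // p_enorm.
Qed.

Lemma q_enorm i : (i < N)%N -> enorm (q i) <= 2.
Proof.
move=> iN; rewrite -(subrK (p i) (q i)) -/(f i).
apply: le_trans (enormD _ _) _.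
have := f_enorm iN; have := p_enorm iN; have := dl_le; lra.
Qed.

Let g i := dot (p i) (q i.+1).

Lemma qp_next i : (i.+1 < N)%N -> dot (q i) (p i.+1) = 0.
Proof.
move=> iN; have [wE bn] := w_next iN.
have := qw0 (ltnW iN); rewrite wE dotZr => /eqP.
by rewrite mulf_eq0 (negPf bn) => /eqP.
Qed.

(** The overlap [<q_i, p_(i+1)>] vanishes exactly, so [<p_i, p_(i+1)> = - <f_i, p_(i+1)>], and the
    opposite overlap [g i] consists of terms in [f] only. *)
Lemma g_small i : (i.+1 < N)%N -> `|g i| <= 4 * dl.
Proof.
move=> iN; have iN' := ltnW iN.
have -> : g i = dot (p i) (f i.+1) - dot (f i) (p i.+1).
  have h := qp_next iN; rewrite -(subrK (p i) (q i)) dotDl -/(f i) in h.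
  rewrite /g -{1}(subrK (p i.+1) (q i.+1)) dotDr -/(f i.+1); lra.
apply: le_trans (ler_normB _ _) _.
have h1 : `|dot (p i) (f i.+1)| <= 11/10 * (11/10 * dl).
  apply: le_trans (dot_le _ _) _.
  by apply: ler_pM; rewrite ?enorm_ge0 ?p_enorm ?f_enorm.
have h2 : `|dot (f i) (p i.+1)| <= 11/10 * (11/10 * dl).
  apply: le_trans (dot_le _ _) _; rewrite mulrC.
  by apply: ler_pM; rewrite ?enorm_ge0 ?p_enorm ?f_enorm.
have := dl_ge0; lra.
Qed.

Let qk i := dot (q i) (B *m q i) + mu * dot (q i) (f i).

Lemma al0E : al 0%N = qk 0%N.
Proof.
have := congr1 (dot (q 0%N)) (three_term N_gt0).
by rewrite be0 /qk /f !dot_lin qw0 // (dotC (q _) (p _)) pq1 //; lra.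
Qed.

Lemma alSE i : (i.+1 < N)%N -> al i.+1 = qk i.+1 - be i.+1 * g i.
Proof.
move=> iN; have := congr1 (dot (q i.+1)) (three_term iN).
by rewrite /= /qk /f !dot_lin qw0 // !(dotC (q _) (p _)) pq1 // -/(g i); lra.
Qed.

Lemma qk_up i : (i < N)%N -> qk i <= 5 * La.
Proof.
move=> iN; rewrite /qk.
have h1 : dot (q i) (q i) <= 4.
  rewrite -enorm_sqr (_ : 4 = 2 ^+ 2); last by ring.
  by rewrite lerXn2r ?nnegrE ?enorm_ge0 ?q_enorm.
have h2 := le_trans (B_up (q i)) (ler_wpM2l (ltW La_gt0) h1).
have h3 : dot (q i) (f i) <= 2 * (11/10 * dl).
  apply: le_trans (ler_norm _) _; apply: le_trans (dot_le _ _) _.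
  by apply: ler_pM; rewrite ?enorm_ge0 ?q_enorm ?f_enorm.
have h4 : dot (q i) (f i) <= 1 by have := dl_le; lra.
have h5 := ler_wpM2l mu_ge0 h4.
have := mu_le; have := m_le_La; lra.
Qed.

(** Completing the square in [be i.+1] bounds its contribution to the next pivot by [d_i g_i^2 / 4],
    however large [be i.+1] is. *)
Lemma pivot_up i : (i < N)%N -> (forall j, (j < i)%N -> 0 < d j) -> d i <= 8 * La.
Proof.
elim: i => [|i ih] iN dp /=.
  by rewrite al0E; have := qk_up iN; have := La_gt0; lra.
have di : 0 < d i by apply: dp.
have di8 : d i <= 8 * La by apply: ih (ltnW iN) _ => j ji; apply: dp; apply: ltnW.
rewrite alSE //; have h := qk_up iN; have hg := g_small iN.
have g2 : g i ^+ 2 <= 1.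
  rewrite -real_normK ?num_real // exprn_ile1 //.
  by have := dl_le; lra.
have sq : - be i.+1 * g i - be i.+1 ^+ 2 / d i <= d i * g i ^+ 2 / 4.
  rewrite -subr_ge0.
  rewrite (_ : _ - _ = (be i.+1 + d i * g i / 2) ^+ 2 / d i); last first.
    by field; rewrite gt_eqF.
  by rewrite divr_ge0 ?sqr_ge0 // ltW.
have := ler_wpM2l (ltW di) g2; have := La_gt0; lra.
Qed.

(** Positivity of the pivot gives [be^2 < al * 8 La], hence [|be| <= al + 8 La]. In [alSE] this is
    multiplied by [|g| <= 1/100] and absorbed into [al]. *)
Lemma al_up i : (i < N)%N -> (forall j, (j <= i)%N -> 0 < d j) -> al i <= 20 * La.
Proof.
case: i => [|i] iN dp; first by rewrite al0E; have := qk_up iN; have := La_gt0; lra.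
have di : 0 < d i by apply: dp.
have di8 : d i <= 8 * La by apply: pivot_up (ltnW iN) _ => j ji; apply: dp; apply/ltnW/ltnW.
have := dp i.+1 (leqnn _) => /=; rewrite subr_gt0 ltr_pdivrMr // => bal.
have h := qk_up iN; have hg := g_small iN; have aE := alSE iN.
have g1 : `|g i| <= 100^-1 by have := dl_le; lra.
have al0 : 0 < al i.+1 by rewrite -(pmulr_lgt0 _ di); apply: le_lt_trans bal; rewrite sqr_ge0.
have bg : - (be i.+1 * g i) <= `|be i.+1| / 100.
  apply: le_trans (ler_norm _) _; rewrite normrN normrM.
  by rewrite ler_wpM2l // (le_trans g1) // lexx.
have b2 : `|be i.+1| ^+ 2 <= al i.+1 * (8 * La).
  by rewrite real_normK ?num_real // (le_trans (ltW bal)) // ler_wpM2l // ltW.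
have b3 : `|be i.+1| <= al i.+1 + 8 * La.
  rewrite -ler_sqr ?nnegrE //; first last.
    by rewrite addr_ge0 ?ltW // mulr_gt0.
  apply: le_trans b2 _; rewrite sqrrD.
  have := sqr_ge0 (al i.+1); have := sqr_ge0 (8 * La).
  have : 0 <= al i.+1 * (8 * La) by rewrite mulr_ge0 ?ltW // mulr_gt0.
  lra.
have := La_gt0; lra.
Qed.

(* [sg i *: nu i] is the [i]-th conjugate direction, a column of [Q L^-T]; [z i] is
   the image of [nu i] under [B] up to the inexactness [ph i]. *)
Let nu i : 'cV[R]_n := \sum_(j < i.+1) (sg j)^-1 *: q j.
Let ph i : 'cV[R]_n := \sum_(j < i.+1) (sg j)^-1 *: (mu *: f j).
Let z i := B *m nu i + ph i.

(* Stated through [w], so that the residual after the last step makes sense even if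
   the recurrence breaks down there. *)
Definition resid i : 'cV[R]_n := if i is j.+1 then - (sg j / d j) *: w j else p 0%N.

Lemma resid_scale i : (i < N)%N -> resid i = sg i *: p i.
Proof.
case: i => [|i] iN /=; first by rewrite scale1r.
have [-> _] := w_next iN; rewrite scalerA; congr (_ *: _); ring.
Qed.

Lemma sg_neq0 i : (i < N)%N -> (forall j, (j < i)%N -> 0 < d j) -> sg i != 0.
Proof.
move=> iN dp; apply: scale_neq0 => j ji; split; first by rewrite gt_eqF // dp.
by have [] := w_next (leq_ltn_trans ji iN).
Qed.

(** Column [i] of [T L^-T = L D]. In the induction the new [be i.+1 *: p i] cancels [d i *: p i],
    and [w i] turns [al i.+1] into the pivot. *)
Lemma zE i : (i < N)%N -> (forall j, (j < i)%N -> 0 < d j) ->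
  z i = (sg i)^-1 *: (d i *: p i + w i).
Proof.
elim: i => [|i ih] iN dp.
  rewrite /z /nu /ph !big_ord1 -scalemxAr -scalerDr three_term // be0.
  by rewrite scale0r add0r.
have iN' := ltnW iN.
have dp' j : (j < i)%N -> 0 < d j by move=> ji; apply: dp; apply: ltnW.
have sn := sg_neq0 iN dp; have sn' := sg_neq0 iN' dp'.
have dn : d i != 0 by rewrite gt_eqF // dp.
have [wE bn] := w_next iN.
have -> : z i.+1 = z i + (sg i.+1)^-1 *: (B *m q i.+1 + mu *: f i.+1).
  rewrite /z /nu /ph !(big_ord_recr i.+1) /= mulmxDr -!scalemxAr [_ *: (B *m _ + _)]scalerDr.
  by rewrite addrACA.
rewrite ih // three_term // wE /=.
apply/matrixP => a b; rewrite !mxE; field.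
by rewrite dn bn sn'.
Qed.

(* Vanishes identically when all solves are exact. *)
Let ze i := dot (nu i) (z i) - d i / sg i ^+ 2.

Lemma ze0 : ze 0%N = 0.
Proof.
rewrite /ze zE // /nu big_ord1 /= invr1 !scale1r !dot_lin qw0 // (dotC (q _)) pq1 //.
by field.
Qed.

(** Symmetry of [B] trades [<nu_i, B q_(i+1)>] for [<q_(i+1), B nu_i>], which [zE] evaluates. The
    pivot recurrence then absorbs everything except terms carrying [g], [f] or [ph]. *)
Lemma zeS i : (i.+1 < N)%N -> (forall j, (j <= i)%N -> 0 < d j) ->
  ze i.+1 = ze i + d i * g i / (sg i * sg i.+1)
    + (mu * dot (nu i) (f i.+1) - dot (ph i) (q i.+1)) / sg i.+1.
Proof.
move=> iN dp; have iN' := ltnW iN.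
have dp' j : (j < i)%N -> 0 < d j by move=> ji; apply: dp; apply: ltnW.
have sn := sg_neq0 iN dp; have sn' := sg_neq0 iN' dp'.
have dn : d i != 0 by rewrite gt_eqF // dp.
have [wE bn] := w_next iN.
set k := B *m q i.+1 + mu *: f i.+1.
have nuS : nu i.+1 = nu i + (sg i.+1)^-1 *: q i.+1 by rewrite /nu big_ord_recr.
have zS : z i.+1 = z i + (sg i.+1)^-1 *: k.
  rewrite /z nuS /ph (big_ord_recr i.+1) /= mulmxDr -!scalemxAr [_ *: (B *m _ + _)]scalerDr.
  by rewrite addrACA.
have qz : dot (q i.+1) (z i) = (d i * g i + be i.+1) / sg i.
  rewrite zE // wE !dot_lin !(dotC (q _)) pq1 // -/(g i); ring.
have nk : dot (nu i) k = dot (q i.+1) (z i) - dot (ph i) (q i.+1) + mu * dot (nu i) (f i.+1).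
  rewrite /k /z !dot_lin -(dot_sym _ _ B_sym) (dotC (q _)) (dotC (q _) (ph i)); ring.
have qkE : dot (q i.+1) k = be i.+1 * g i + al i.+1.
  by rewrite alSE // /qk /k dotDr dotZr; ring.
rewrite /ze zS nuS; clearbody k; move: (z i) (f i.+1) nk qz => zi fi nk qz.
rewrite !dot_lin nk qz qkE /=; field.
by rewrite sn' dn bn.
Qed.

(** Under exact biorthogonality only the last term of [nu i] contributes, and this is 1; its drift
    from 1 measures the lost orthogonality. *)
Let ppi i := dot (resid i) (nu i).

Lemma ppi0 : ppi 0%N = 1.
Proof. by rewrite /ppi /= /nu big_ord1 /= invr1 scale1r pq1. Qed.

(** A conjugate gradient update along [nu i], with [z i] in place of [B nu_i]. *)
Lemma residS i : (i < N)%N -> (forall j, (j <= i)%N -> 0 < d j) ->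
  resid i.+1 = resid i - (sg i ^+ 2 / d i) *: z i.
Proof.
move=> iN dp; have dn : d i != 0 by rewrite gt_eqF // dp.
have dp' j : (j < i)%N -> 0 < d j by move=> ji; apply: dp; apply: ltnW.
have sn := sg_neq0 iN dp'.
rewrite (resid_scale iN) (zE iN dp') /=.
by apply/matrixP => a b; rewrite !mxE; field; rewrite sn dn.
Qed.

Lemma ppiS i : (i.+1 < N)%N -> (forall j, (j <= i)%N -> 0 < d j) ->
  ppi i.+1 = ppi i - sg i ^+ 2 * ze i / d i.
Proof.
move=> iN dp; have iN' := ltnW iN; have dn : d i != 0 by rewrite gt_eqF // dp.
have dp' j : (j < i)%N -> 0 < d j by move=> ji; apply: dp; apply: ltnW.
have sn := sg_neq0 iN dp; have sn' := sg_neq0 iN' dp'.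
have nuS : nu i.+1 = nu i + (sg i.+1)^-1 *: q i.+1 by rewrite /nu big_ord_recr.
have rq : dot (resid i.+1) (q i.+1) = sg i.+1.
  by rewrite (resid_scale iN) dotZl pq1 // mulr1.
rewrite /ppi nuS dotDr dotZr rq residS // /ze (dotC (nu i) (z i)).
move: (z i) => zi.
rewrite !dot_lin -/(ppi i).
by field; rewrite sn sn' dn.
Qed.

Definition energy i := dot (resid i) (K *m resid i).

(** Expand the square after [residS], using [K z_i = nu_i + K ph_i]. With exact solves the bracket
    is [2 - 1 = 1] and the energy drops by [sg i ^+ 2 / d i]. *)
Lemma energyS i : (i < N)%N -> (forall j, (j <= i)%N -> 0 < d j) ->
  energy i.+1 = energy i - sg i ^+ 2 / d i *
    (2 * ppi i + 2 * dot (resid i) (K *m ph i) - 1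
     - (sg i ^+ 2 * ze i + sg i ^+ 2 * dot (nu i) (ph i)
        + sg i ^+ 2 * dot (ph i) (K *m ph i)) / d i).
Proof.
move=> iN dp; have dn : d i != 0 by rewrite gt_eqF // dp.
have dp' j : (j < i)%N -> 0 < d j by move=> ji; apply: dp; apply: ltnW.
have sn := sg_neq0 iN dp'.
have Ks : K^T = K by exact: inv_sym.
have Kz : K *m z i = nu i + K *m ph i.
  by rewrite /z mulmxDr (mulBK m_gt0 B_lo).
have zKz : dot (z i) (K *m z i) =
    ze i + d i / sg i ^+ 2 + dot (nu i) (ph i) + dot (ph i) (K *m ph i).
  rewrite Kz dotDr -(dot_sym (z i) (ph i) Ks) Kz dotDl (dotC (K *m ph i)) /ze.
  by rewrite (dotC (nu i) (z i)); ring.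
rewrite /energy residS //; move: (z i) Kz zKz => zi Kz zKz.
rewrite !(mulmxDr, mulmxN) -!scalemxAr !dot_lin.
rewrite -{1}(dot_sym zi (resid i) Ks) zKz (dotC _ (resid i)) Kz !dot_lin -/(ppi i).
by field; rewrite sn dn.
Qed.

(** * Energies, scales and the stability induction *)

Lemma energy_lo i : (i < N)%N -> sg i ^+ 2 / 2 <= La * energy i.
Proof.
move=> iN; have := inv_form_lo B_sym m_gt0 B_lo (resid i) B_up.
apply: le_trans; rewrite (resid_scale iN) !dot_lin mulrA -expr2.
by rewrite ler_wpM2l ?sqr_ge0 //; have /andP[] := p_norm iN.
Qed.

Lemma energy_up i : (i < N)%N -> energy i <= sg i ^+ 2 * 2 / m.
Proof.
move=> iN; have := inv_form_up m_gt0 B_lo (resid i) => h; apply: le_trans h _.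
rewrite (resid_scale iN) !dot_lin mulrA -expr2 ler_wpM2r ?invr_ge0 ?(ltW m_gt0) //.
by rewrite ler_wpM2l ?sqr_ge0 //; have /andP[_] := p_norm iN; lra.
Qed.

(** The invariants are proved together: decreasing energies control the scales, hence the errors,
    hence the next pivot and the next energy. *)
Definition stable i := [/\ forall j, (j < i)%N -> m / 16 <= d j,
  forall j, (j < i)%N -> energy j.+1 <= energy j &
  forall j, (j <= i)%N -> (j < N)%N -> `|ppi j - 1| <= 16 * iota * j%:R].

Lemma stable_pos i : stable i -> forall j, (j < i)%N -> 0 < d j.
Proof. by case=> h _ _ j ji; apply: lt_le_trans (h j ji); rewrite divr_gt0. Qed.

(** As [resid i = sg i *: p i] with [p i] of nearly unit length, the energy is comparable to
    [sg i ^+ 2]. Monotone energies bound the squared ratio by [2 * rho], which is at most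
    [rho ^+ 2]. *)
Lemma scale_ratio i j k : (i < N)%N -> stable i -> (j <= k)%N -> (k <= i)%N ->
  `|sg k| <= rho * `|sg j|.
Proof.
move=> iN [_ eh _] jk ki.
have ekj : energy k <= energy j.
  elim: k jk ki => [|k ih]; first by rewrite leqn0 => /eqP ->.
  rewrite leq_eqVlt => /orP[/eqP-> //|jk] ki.
  by apply: le_trans (eh k ki) _; apply: ih => //; apply: ltnW.
have kN := leq_ltn_trans ki iN; have jN := leq_ltn_trans jk kN.
have r0 := le_trans (ler0n R 2) rho_ge2.
rewrite -ler_sqr ?nnegrE ?normr_ge0 ?mulr_ge0 //.
rewrite exprMn !real_normK ?num_real //.
have h1 := le_trans (energy_lo kN) (ler_wpM2l (ltW La_gt0) (le_trans ekj (energy_up jN))).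
have h2 : La * (sg j ^+ 2 * 2 / m) = rho * sg j ^+ 2 by rewrite rhoE; ring.
have h3 : rho * 2 * sg j ^+ 2 <= rho ^+ 2 * sg j ^+ 2.
  by rewrite ler_wpM2r ?sqr_ge0 // expr2 ler_wpM2l.
rewrite h2 in h1; lra.
Qed.

Lemma comb_enorm (v : nat -> 'cV[R]_n) c i k : (i < N)%N -> stable i -> (k <= i)%N ->
  0 <= c -> (forall j, (j < N)%N -> enorm (v j) <= c) ->
  `|sg i| * enorm (\sum_(j < k.+1) (sg j)^-1 *: v j) <= rho * N%:R * c.
Proof.
move=> iN si ki c0 vc.
have r0 := le_trans (ler0n R 2) rho_ge2.
apply: le_trans (ler_wpM2l (normr_ge0 _) (enorm_sum (fun j => (sg j)^-1 *: v j) _)) _.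
rewrite mulr_sumr.
have h (j : 'I_k.+1) : `|sg i| * enorm ((sg j)^-1 *: v j) <= rho * c.
  have ji : (j <= i)%N by apply: leq_trans ki; rewrite -ltnS.
  have jN := leq_ltn_trans ji iN.
  have sj : sg j != 0.
    by apply: sg_neq0 => // l lj; apply: (stable_pos si); apply: leq_trans ji.
  rewrite enormZ normfV mulrA; apply: ler_pM; rewrite ?enorm_ge0 ?divr_ge0 ?vc //.
  by rewrite ler_pdivrMr ?normr_gt0 // (scale_ratio iN si).
apply: le_trans (ler_sum _ (fun j _ => h j)) _.
rewrite sumr_const card_ord.
rewrite (_ : _ *+ k.+1 = rho * k.+1%:R * c); last by rewrite -[LHS]mulr_natr; ring.
rewrite ler_wpM2r // ler_wpM2l // ler_nat.
exact: leq_ltn_trans iN.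
Qed.

Lemma nu_enorm i k : (i < N)%N -> stable i -> (k <= i)%N ->
  `|sg i| * enorm (nu k) <= rho * N%:R * 2.
Proof. by move=> iN si ki; apply: (comb_enorm iN si) => //; apply: q_enorm. Qed.

Lemma ph_enorm i k : (i < N)%N -> stable i -> (k <= i)%N ->
  `|sg i| * enorm (ph k) <= rho * N%:R * (m * (11/10 * dl)).
Proof.
move=> iN si ki; apply: (@comb_enorm (fun j => mu *: f j)) => //.
  by rewrite !mulr_ge0 // ltW.
move=> j jN; rewrite enormZ ger0_norm //.
by apply: ler_pM; rewrite ?enorm_ge0 ?f_enorm.
Qed.

(** Sums the increments of [zeS]. Multiplication by [sg i ^+ 2] turns the denominators into two
    scale ratios, each at most [rho]. *)
Lemma ze_small i k : (i < N)%N -> stable i -> (k <= i)%N ->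
  sg i ^+ 2 * `|ze k| <= k%:R * (rho ^+ 2 * (32 * La + 10 * N%:R * m) * dl).
Proof.
move=> iN si; have r0 := le_trans (ler0n R 2) rho_ge2.
elim: k => [|k ih] ki; first by rewrite ze0 normr0 mulr0 mul0r.
have kN := leq_ltn_trans ki iN; have kN' := ltnW kN.
have dp j : (j <= k)%N -> 0 < d j.
  by move=> jk; apply: (stable_pos si); apply: leq_ltn_trans ki.
have dp' j : (j < k)%N -> 0 < d j by move=> jk; apply: dp; apply: ltnW.
have sn := sg_neq0 kN dp; have sn' := sg_neq0 kN' dp'.
rewrite zeS //.
set t1 := _ / (sg k * _); set t2 := _ / sg k.+1.
have b0 : 0 < `|sg k.+1| by rewrite normr_gt0.
have b0' : 0 < `|sg k| by rewrite normr_gt0.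
have R1 : `|sg i| / `|sg k.+1| <= rho by rewrite ler_pdivrMr // (scale_ratio iN si).
have R2 : `|sg i| / `|sg k| <= rho by rewrite ler_pdivrMr // (scale_ratio iN si) // ltnW.
have h1 : sg i ^+ 2 * `|t1| <= rho ^+ 2 * (32 * La) * dl.
  have -> : sg i ^+ 2 * `|t1| =
      `|sg i| / `|sg k| * (`|sg i| / `|sg k.+1|) * (d k * `|g k|).
    rewrite /t1; move: (sg k.+1) b0 => s' b0.
    rewrite !normrM normfV normrM (gtr0_norm (dp _ (leqnn _))).
    rewrite -[sg i ^+ 2]real_normK ?num_real //; field.
    by rewrite !gt_eqF.
  rewrite (_ : rho ^+ 2 * _ * _ = (rho * rho) * (8 * La * (4 * dl))); last by ring.
  apply: ler_pM; rewrite ?mulr_ge0 ?invr_ge0 ?normr_ge0 ?(ltW (dp _ (leqnn _))) //.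
    by apply: ler_pM; rewrite ?mulr_ge0 ?invr_ge0 ?normr_ge0.
  by apply: ler_pM; rewrite ?normr_ge0 ?(ltW (dp _ (leqnn _))) ?g_small ?pivot_up.
have h2 : sg i ^+ 2 * `|t2| <= rho ^+ 2 * (10 * N%:R * m) * dl.
  have -> : sg i ^+ 2 * `|t2| = (`|sg i| / `|sg k.+1|) *
      (`|sg i| * `|mu * dot (nu k) (f k.+1) - dot (ph k) (q k.+1)|).
    rewrite /t2; move: (sg k.+1) b0 => s' b0.
    rewrite normrM normfV -[sg i ^+ 2]real_normK ?num_real //; field.
    by rewrite gt_eqF.
  (* The two error terms use 22/10 each; the summand 56/10 is slack that rounds the constant to
     10. *)
  rewrite (_ : rho ^+ 2 * _ * _ = rho * (rho * N%:R * 2 * (m * (11/10 * dl)) +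
     rho * N%:R * (m * (11/10 * dl)) * 2 + 56/10 * rho * N%:R * m * dl)); last by field.
  apply: ler_pM; rewrite ?mulr_ge0 ?invr_ge0 ?normr_ge0 //.
  apply: le_trans (ler_wpM2l (normr_ge0 _) (ler_normB _ _)) _.
  have e1 : `|sg i| * `|mu * dot (nu k) (f k.+1)| <= rho * N%:R * 2 * (m * (11/10 * dl)).
    rewrite normrM (ger0_norm mu_ge0).
    apply: le_trans (_ : (`|sg i| * enorm (nu k)) * (mu * enorm (f k.+1)) <= _).
      have := ler_wpM2l (mulr_ge0 (normr_ge0 (sg i)) mu_ge0) (dot_le (nu k) (f k.+1)).
      by congr (_ <= _); ring.
    apply: ler_pM; rewrite ?mulr_ge0 ?enorm_ge0 ?normr_ge0 // ?nu_enorm ?(ltnW ki) //.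
    by apply: ler_pM; rewrite ?enorm_ge0 ?f_enorm.
  have e2 : `|sg i| * `|dot (ph k) (q k.+1)| <= rho * N%:R * (m * (11/10 * dl)) * 2.
    apply: le_trans (_ : (`|sg i| * enorm (ph k)) * enorm (q k.+1) <= _).
      by rewrite -mulrA ler_wpM2l ?normr_ge0 ?dot_le.
    apply: ler_pM; rewrite ?mulr_ge0 ?enorm_ge0 ?normr_ge0 // ?ph_enorm ?(ltnW ki) //.
    exact: q_enorm.
  have e3 : 0 <= 56/10 * rho * N%:R * m * dl.
    by rewrite !mulr_ge0 // ltW.
  rewrite mulrDr; lra.
rewrite -addrA; apply: le_trans (ler_wpM2l (sqr_ge0 _) (ler_normD _ _)) _.
have h3 := ler_wpM2l (sqr_ge0 (sg i)) (ler_normD t1 t2).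
have h4 := ih (ltnW ki).
rewrite -natr1 mulrDl mul1r mulrDr.
move: h1 h2 h3 h4; rewrite mulrDr; lra.
Qed.

Lemma ze_iota i : (i < N)%N -> stable i -> sg i ^+ 2 * `|ze i| <= iota * m.
Proof.
move=> iN si; apply: le_trans (ze_small iN si (leqnn _)) _.
have r0 := le_trans (ler0n R 2) rho_ge2.
have LaE : La = rho * m / 2 by rewrite rhoE; field; rewrite gt_eqF.
apply: le_trans (_ : N%:R * (rho ^+ 2 * (32 * La + 10 * N%:R * m) * dl) <= _).
  rewrite ler_wpM2r ?ler_nat ?(ltnW iN) // !mulr_ge0 ?exprn_ge0 //.
  by rewrite addr_ge0 // !mulr_ge0 // ltW // La_gt0.
rewrite {1}LaE.
have -> : iota * m = N%:R * (rho ^+ 2 * (16 * N%:R * rho ^+ 2 * m) * dl).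
  by rewrite /iota; ring.
rewrite ler_wpM2l // ler_wpM2r // ler_wpM2l ?exprn_ge0 //.
rewrite (_ : 32 * _ + _ = (16 * rho + 10 * N%:R) * m); last by field.
rewrite ler_wpM2r ?(ltW m_gt0) //.
have k1 : 0 <= (N%:R - 1) * rho by rewrite mulr_ge0 // subr_ge0.
have k2 : 0 <= N%:R * rho * (rho - 2) by rewrite !mulr_ge0 // subr_ge0.
have k3 : 0 <= N%:R * (rho - 2) by rewrite !mulr_ge0 // subr_ge0.
rewrite expr2; lra.
Qed.

Lemma stable_step i : (i < N)%N -> stable i -> stable i.+1.
Proof.
move=> iN si; have r0 := le_trans (ler0n R 2) rho_ge2.
have dp := stable_pos si; have sn := sg_neq0 iN dp.
have [hd he hp] := si.
have io : iota <= 128^-1.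
  by apply: le_trans iota_small; rewrite ler_peMl.
have zi := ze_iota iN si.
have nue := nu_enorm iN si (leqnn _); have phe := ph_enorm iN si (leqnn _).
have s0 : 0 <= `|sg i| by [].
have pp : 7/8 <= ppi i <= 9/8.
  have := hp i (leqnn _) iN; rewrite ler_norml => /andP[h1 h2].
  have : 16 * iota * i%:R <= 8^-1.
    apply: le_trans (_ : 16 * (N%:R * iota) <= _).
      rewrite -mulrA (mulrC iota) ler_wpM2l // ler_wpM2r // ler_nat ltnW //.
    have := iota_small; lra.
  lra.
have N1 : rho * N%:R * dl * 70 <= iota.
  have -> : iota = rho * N%:R * dl * (16 * (rho ^+ 3 * N%:R)) by rewrite /iota; ring.
  rewrite ler_wpM2l ?mulr_ge0 // (_ : 70 = 16 * (70 / 16)); last by field.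
  rewrite ler_wpM2l // (le_trans (_ : _ <= 8 * 1)) //; first by lra.
  apply: ler_pM => //.
  by rewrite (_ : 8 = 2 ^+ 3); [rewrite lerXn2r ?nnegrE | ring].
have nuph : sg i ^+ 2 * `|dot (nu i) (ph i)| <= iota * m.
  apply: le_trans (_ : (`|sg i| * enorm (nu i)) * (`|sg i| * enorm (ph i)) <= _).
    rewrite mulrACA -expr2 real_normK ?num_real // ler_wpM2l ?sqr_ge0 ?dot_le //.
  apply: le_trans (_ : (rho * N%:R * 2) * (rho * N%:R * (m * (11/10 * dl))) <= _).
    by apply: ler_pM; rewrite ?mulr_ge0 ?enorm_ge0.
  have -> : iota * m = (rho * N%:R) * (rho * N%:R * (m * dl)) * (16 * rho ^+ 2).
    by rewrite /iota; ring.
  rewrite (_ : rho * N%:R * 2 * _ =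
    (rho * N%:R) * (rho * N%:R * (m * dl)) * (22 / 10)); last by field.
  rewrite ler_wpM2l ?mulr_ge0 // ?(ltW m_gt0) //.
  have : 2 * 2 <= rho ^+ 2 by rewrite expr2; apply: ler_pM.
  lra.
have Kph : `|sg i| * enorm (K *m ph i) <= iota / 50.
  apply: le_trans (ler_wpM2l s0 (inv_enorm m_gt0 B_lo _)) _.
  rewrite mulrA ler_pdivrMr //; apply: le_trans phe _.
  have := ler_wpM2r (ltW m_gt0) N1; have := mulr_ge0 iota_ge0 (ltW m_gt0); lra.
have phKph : sg i ^+ 2 * `|dot (ph i) (K *m ph i)| <= iota * m.
  apply: le_trans (_ : (`|sg i| * enorm (ph i)) * (`|sg i| * enorm (K *m ph i)) <= _).
    rewrite mulrACA -expr2 real_normK ?num_real // ler_wpM2l ?sqr_ge0 ?dot_le //.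
  apply: le_trans (_ : (iota * m) * 1 <= _); last by rewrite mulr1.
  apply: ler_pM; rewrite ?mulr_ge0 ?enorm_ge0 //; last by lra.
  apply: le_trans phe _.
  have := ler_wpM2r (ltW m_gt0) N1; have := mulr_ge0 iota_ge0 (ltW m_gt0); lra.
have rKph : `|dot (resid i) (K *m ph i)| <= iota.
  apply: le_trans (dot_le _ _) _; rewrite (resid_scale iN) enormZ.
  rewrite (_ : _ * _ * _ = enorm (p i) * (`|sg i| * enorm (K *m ph i))); last by ring.
  apply: le_trans (_ : 2 * (iota / 50) <= _); last by have := iota_ge0; lra.
  apply: ler_pM; rewrite ?mulr_ge0 ?enorm_ge0 //.
  by have := p_enorm iN; lra.
have s2 : 0 < sg i ^+ 2 by rewrite lt_def sqrf_eq0 sn sqr_ge0.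
(* Cauchy-Schwarz against [p i] keeps [sg i *: nu i] away from 0 because [ppi i] is near 1.
   Coercivity then gives about [m / 2], and the two error terms cost at most [m / 128] each. *)
have dlo : m / 16 <= d i.
  have dE : d i = sg i ^+ 2 * (dot (nu i) (B *m nu i) + dot (nu i) (ph i) - ze i).
    by rewrite /ze /z dotDr; field.
  have nuB : m * (sg i ^+ 2 * dot (nu i) (nu i)) <= sg i ^+ 2 * dot (nu i) (B *m nu i).
    by rewrite mulrCA ler_wpM2l ?sqr_ge0.
  have nulo : 2^-1 <= sg i ^+ 2 * dot (nu i) (nu i).
    have := dot_cauchy (p i) (sg i *: nu i).
    have -> : dot (p i) (sg i *: nu i) = ppi i.
      by rewrite /ppi (resid_scale iN) !dot_lin.
    have -> : dot (sg i *: nu i) (sg i *: nu i) = sg i ^+ 2 * dot (nu i) (nu i).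
      by rewrite dotZl dotZr mulrA -expr2.
    move=> h.
    have /andP[_ h1] := p_norm iN.
    have h2 := le_trans h (ler_wpM2r (mulr_ge0 (sqr_ge0 (sg i)) (dot_ge0 (nu i))) h1).
    have : (7/8) ^+ 2 <= ppi i ^+ 2.
      by case/andP: pp => pp1 pp2; rewrite lerXn2r ?nnegrE //; lra.
    lra.
  have a1 : - (iota * m) <= sg i ^+ 2 * dot (nu i) (ph i).
    have : - (sg i ^+ 2 * `|dot (nu i) (ph i)|) <= sg i ^+ 2 * dot (nu i) (ph i).
      by rewrite -mulrN ler_wpM2l ?sqr_ge0 // lerNl -normrN ler_norm.
    lra.
  have a2 : sg i ^+ 2 * ze i <= iota * m.
    by apply: le_trans zi; rewrite ler_wpM2l ?sqr_ge0 // ler_norm.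
  have a3 := ler_wpM2r (ltW m_gt0) io; have a4 := ler_wpM2l (ltW m_gt0) nulo.
  rewrite dE; have := m_gt0; lra.
have di : 0 < d i by apply: lt_le_trans dlo; rewrite divr_gt0.
have dp' j : (j <= i)%N -> 0 < d j.
  by rewrite leq_eqVlt => /orP[/eqP-> //|]; apply: dp.
have imd : iota * m / d i <= 16 * iota.
  rewrite ler_pdivrMr //; have := ler_wpM2l iota_ge0 dlo; lra.
split.
- by move=> j; rewrite ltnS leq_eqVlt => /orP[/eqP-> //|]; apply: hd.
- move=> j; rewrite ltnS leq_eqVlt => /orP[/eqP->|]; last exact: he.
  (* The bracket is at least [2 * 7/8 - 1 - 50 * iota], positive because [iota <= 1/128]. *)
  rewrite energyS // gerBl mulr_ge0 //; first by rewrite divr_ge0 ?ltW.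
  have : (sg i ^+ 2 * ze i + sg i ^+ 2 * dot (nu i) (ph i) +
          sg i ^+ 2 * dot (ph i) (K *m ph i)) / d i <= 48 * iota.
    have -> : 48 * iota = 3 * (16 * iota) by ring.
    apply: le_trans (ler_wpM2l _ imd) => //; rewrite mulrA ler_wpM2r ?invr_ge0 ?(ltW di) //.
    have b1 := ler_wpM2l (sqr_ge0 (sg i)) (ler_norm (ze i)).
    have b2 := ler_wpM2l (sqr_ge0 (sg i)) (ler_norm (dot (nu i) (ph i))).
    have b3 := ler_wpM2l (sqr_ge0 (sg i)) (ler_norm (dot (ph i) (K *m ph i))).
    lra.
  move: rKph; rewrite ler_norml => /andP[c1 c2]; case/andP: pp => pp1 pp2; lra.
- move=> j; rewrite leq_eqVlt => /orP[/eqP->|]; last exact: hp.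
  move=> iN'; rewrite ppiS //.
  rewrite (_ : _ - _ = (ppi i - 1) - sg i ^+ 2 * ze i / d i); last by ring.
  apply: le_trans (ler_normB _ _) _.
  have -> : 16 * iota * i.+1%:R = 16 * iota * i%:R + 16 * iota.
    by rewrite -[i.+1%:R]natr1; ring.
  apply: lerD; first exact: hp.
  rewrite normrM normfV (gtr0_norm di) normrM (gtr0_norm s2).
  by apply: le_trans imd; rewrite ler_wpM2r ?invr_ge0 ?(ltW di).
Qed.

Lemma stableN : stable N.
Proof.
have h i : (i <= N)%N -> stable i.
  elim: i => [|i ih] iN; last by apply: stable_step iN (ih (ltnW iN)).
  split=> // j; rewrite leqn0 => /eqP-> _.
  by rewrite ppi0 subrr normr0 mulr0.
exact: h.
Qed.

Lemma pivot_ge i : (i < N)%N -> m / 16 <= d i.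
Proof. by have [h _ _] := stableN; apply: h. Qed.

Lemma energy_dec i : (i < N)%N -> energy i.+1 <= energy i.
Proof. by have [_ h _] := stableN; apply: h. Qed.

Lemma energy_le i j : (i <= j)%N -> (j <= N)%N -> energy j <= energy i.
Proof.
elim: j => [|j ih]; first by rewrite leqn0 => /eqP->.
rewrite leq_eqVlt => /orP[/eqP->//|ij] jN.
exact: le_trans (energy_dec jN) (ih ij (ltnW jN)).
Qed.

(** For [mu = 0] the first step carries no error: [ph 0 = 0], [ze 0 = 0] and [ppi 0 = 1]. *)
Lemma energy1 : mu = 0 -> energy 1 = energy 0 - (al 0%N)^-1.
Proof.
move=> mu0; have ph0 : ph 0 = 0 by rewrite /ph big_ord1 mu0 scale0r scaler0.
have dp j : (j <= 0)%N -> 0 < d j.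
  rewrite leqn0 => /eqP->; apply: lt_le_trans (pivot_ge N_gt0).
  by rewrite divr_gt0.
rewrite energyS // ph0 mulmx0 !dot0r ze0 ppi0 /=.
by rewrite expr1n !mulr0 !addr0 mul0r subr0 mulr1 (_ : 2 - 1 = 1) ?mulr1 ?div1r //; ring.
Qed.

Lemma al0_up : mu = 0 -> al 0%N <= 5/4 * La.
Proof.
move=> mu0; rewrite al0E /qk mu0 mul0r addr0.
apply: le_trans (B_up _) _; rewrite mulrC ler_wpM2r ?(ltW La_gt0) //.
have h : enorm (q 0%N) <= 10/9.
  rewrite -(subrK (p 0%N) (q 0%N)); apply: le_trans (enormD _ _) _.
  have := f_enorm N_gt0; have := p_enorm N_gt0; have := dl_le; rewrite /f; lra.
rewrite -enorm_sqr; apply: le_trans (_ : (10/9) ^+ 2 <= _); last by lra.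
have c0 : 0 <= 10/9 :> R by lra.
by rewrite lerXn2r // nnegrE enorm_ge0.
Qed.

End Run.

(** * Chebyshev decay of the last residual entry *)

Section Chebyshev.
Context {R : realType} {n : nat}.
Implicit Types x y z : 'cV[R]_n.+1.
Variables (T : 'M[R]_n.+1) (mu b : R).
Hypothesis T_sym : T^T = T.
Hypothesis mu_gt0 : 0 < mu.
Hypothesis mu_lt_b : mu < b.
Hypothesis T_lo : forall x, mu * dot x x <= dot x (T *m x).
Hypothesis T_up : forall x, dot x (T *m x) <= b * dot x x.

Let eta := 2 / (b - mu).
Let xi := (b + mu) / (b - mu).
(** The affine image of [T] for which the interval from [mu] to [b] becomes that from -1 to 1, while
    0 goes to [xi > 1]. *)
Let X : 'M[R]_n.+1 := xi%:M - eta *: T.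

Let bmu0 : 0 < b - mu. Proof. by rewrite subr_gt0. Qed.
Let bmu_neq0 : b - mu != 0. Proof. by rewrite gt_eqF. Qed.

Let X_sym : X^T = X.
Proof. by rewrite /X raddfB /= tr_scalar_mx linearZ /= T_sym. Qed.

Let XE x : X *m x = xi *: x - eta *: (T *m x).
Proof. by rewrite /X mulmxBl mul_scalar_mx -scalemxAl. Qed.

Let XD_ge0 x : 0 <= dot x x + dot x (X *m x).
Proof.
rewrite XE !dot_lin (_ : _ + _ = (b * dot x x - dot x (T *m x)) * eta); last first.
  by rewrite /xi /eta; field.
by rewrite mulr_ge0 ?subr_ge0 // divr_ge0 // ltW.
Qed.

Let XB_ge0 x : 0 <= dot x x - dot x (X *m x).
Proof.
rewrite XE !dot_lin (_ : _ - _ = (dot x (T *m x) - mu * dot x x) * eta); last first.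
  by rewrite /xi /eta; field.
by rewrite mulr_ge0 ?subr_ge0 // divr_ge0 // ltW.
Qed.

Let W x := x - X *m (X *m x).

Let W_ge0 x : 0 <= dot x (W x).
Proof.
(* [(1 - X)(1 + X)(1 - X) + (1 + X)(1 - X)(1 + X) = 2 (1 - X^2)], and both summands are
   nonnegative. *)
have h1 := XD_ge0 (x - X *m x); have h2 := XB_ge0 (x + X *m x).
have s y z : dot (X *m y) z = dot y (X *m z) by rewrite dot_sym.
move: h1 h2; rewrite /W !(mulmxDr, mulmxN) !dot_lin !s => h1 h2.
lra.
Qed.

Variable w0 : 'cV[R]_n.+1.

(* First- and second-kind Chebyshev polynomials of [X] applied to [w0]. *)
Fixpoint cheb (k : nat) : 'cV[R]_n.+1 * 'cV[R]_n.+1 :=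
  if k is k'.+1 then
    let: (c, u) := cheb k' in (X *m c - W u, X *m u + c)
  else (w0, 0).

(** Inductively, [(x c - (1 - x^2) u)^2 + (1 - x^2) (x u + c)^2 = c^2 + (1 - x^2) u^2], read as
    forms in the symmetric [X]. *)
Lemma cheb_pell k :
  dot (cheb k).1 (cheb k).1 + dot (cheb k).2 (W (cheb k).2) = dot w0 w0.
Proof.
elim: k => [|k <-] /=; first by rewrite dot0l addr0.
case: (cheb k) => c u /=.
have s y z : dot (X *m y) z = dot y (X *m z) by rewrite dot_sym.
rewrite /W !(mulmxDr, mulmxN) !dot_lin !s.
rewrite (dotC u (X *m c)) s.
rewrite (dotC u (X *m (X *m (X *m c)))) !s.
ring.
Qed.

Lemma cheb_le k : enorm (cheb k).1 <= enorm w0.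
Proof.
rewrite -ler_sqr ?nnegrE ?enorm_ge0 // !enorm_sqr -(cheb_pell k).
by rewrite lerDl W_ge0.
Qed.

(* The Chebyshev values at [xi], the image of the point [0]. *)
Fixpoint chebv (k : nat) : R * R :=
  if k is k'.+1 then
    let: (t, u) := chebv k' in (xi * t - (1 - xi ^+ 2) * u, xi * u + t)
  else (1, 0).

Definition supp k (x : 'cV[R]_n.+1) := forall i : 'I_n.+1, (k <= i)%N -> x i 0 = 0.

Hypothesis T_hess : forall i j : 'I_n.+1, (j.+1 < i)%N -> T i j = 0.
Hypothesis w0_supp : supp 1 w0.

Lemma suppD k x y : supp k x -> supp k y -> supp k (x + y).
Proof. by move=> hx hy i ki; rewrite mxE hx // hy // addr0. Qed.

Lemma suppZ k a x : supp k x -> supp k (a *: x).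
Proof. by move=> hx i ki; rewrite mxE hx // mulr0. Qed.

Lemma suppN k x : supp k x -> supp k (- x).
Proof. by move=> hx i ki; rewrite mxE hx // oppr0. Qed.

Lemma supp_le k l x : (k <= l)%N -> supp k x -> supp l x.
Proof. by move=> kl hx i li; rewrite hx // (leq_trans kl). Qed.

Lemma suppT k x : supp k x -> supp k.+1 (T *m x).
Proof.
move=> hx i ki; rewrite mxE big1 // => j _.
have [kj|jk] := leqP k j; first by rewrite hx // mulr0.
by rewrite T_hess ?mul0r //; apply: leq_trans ki.
Qed.

(** A polynomial in [xi - eta T] minus its value at [xi] is divisible by [T]. The quotient has
    degree below [k], so on a multiple of [e_1] it reaches only the first [k] coordinates. *)
Lemma cheb_krylov k : exists g h : 'cV[R]_n.+1,
  [/\ (cheb k).1 = (chebv k).1 *: w0 - T *m g,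
      (cheb k).2 = (chebv k).2 *: w0 - T *m h,
      supp k g, supp k h & supp k.+1 (cheb k).1 /\ supp k (cheb k).2].
Proof.
elim: k => [|k [g [h []]]] /=.
  by exists 0, 0; rewrite mulmx0 scale1r scale0r !subr0; split=> //;
    do ?split=> //; move=> i _; rewrite mxE.
case: (cheb k) (chebv k) => c u [t v] /= cE uE gs hs [cs us].
(* Found by expanding [X c - u + X^2 u] and [X u + c] and collecting what stands behind [- T]. *)
exists (xi *: g + (xi ^+ 2 - 1) *: h + eta *: c + (2 * xi * eta) *: u
        - (eta ^+ 2) *: (T *m u)), (xi *: h + eta *: u + g).
have cs' := supp_le (leqnSn _) cs; have us' := supp_le (leqnSn _) us.
have gs' := supp_le (leqnSn _) gs; have hs' := supp_le (leqnSn _) hs.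
have Xs j x : supp j x -> supp j.+1 (X *m x).
  move=> jx; rewrite XE; apply: suppD; last by apply/suppN/suppZ/suppT.
  exact/suppZ/(supp_le (leqnSn _)).
split.
- rewrite /W !XE !(mulmxDr, mulmxN) -!scalemxAr.
  move: (T *m (T *m u)) (T *m c) (T *m u) (T *m g) (T *m h) cE uE
    => TTu Tc Tu Tg Th -> ->.
  by apply/matrixP => i j; rewrite !mxE; ring.
- rewrite XE !mulmxDr -!scalemxAr.
  move: (T *m c) (T *m u) (T *m g) (T *m h) cE uE => Tc Tu Tg Th -> ->.
  by apply/matrixP => i j; rewrite !mxE; ring.
- by do ![apply: suppD | apply: suppZ | apply: suppN | apply: suppT | done].
- by do ![apply: suppD | apply: suppZ | done].
- split.
    apply: suppD; first exact: Xs.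
    apply/suppN/suppD; first exact: (supp_le (leqnSn _)).
    by apply/suppN/Xs/Xs.
  by apply: suppD => //; apply: Xs.
Qed.

Let s := Num.sqrt (mu / b).

Let b_gt0 : 0 < b. Proof. exact: lt_trans mu_lt_b. Qed.
Let s_gt0 : 0 < s. Proof. by rewrite sqrtr_gt0 divr_gt0. Qed.
Let s_lt1 : s < 1.
Proof. by rewrite -sqrtr1 ltr_sqrt // ltr_pdivrMr // mul1r. Qed.
Let ss : mu = s ^+ 2 * b.
Proof. by rewrite sqr_sqrtr ?divr_ge0 ?ltW // divfK // gt_eqF. Qed.

(** The closed form [2 T_k(xi) = ((1+s)/(1-s))^k + ((1-s)/(1+s))^k], where [xi = (1+s^2)/(1-s^2)]
    and [de] is the square root of [xi^2 - 1]. *)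
Lemma chebv_ge k : ((1 - s)^-1) ^+ k / 2 <= (chebv k).1.
Proof.
have s1 : 0 < 1 - s by rewrite subr_gt0.
have s2 : 0 < 1 + s by rewrite addr_gt0.
have s12 : 1 - s ^+ 2 != 0.
  by rewrite -[1](expr1n R 2) subr_sqr mulf_neq0 // gt_eqF.
have b0 : b != 0 by rewrite gt_eqF.
pose de := 2 * s / (1 - s ^+ 2).
have xiE : xi = (1 + s ^+ 2) / (1 - s ^+ 2).
  rewrite /xi {1 2}ss; field.
  by rewrite s12 (_ : _ - _ = b * (1 - s ^+ 2)) ?mulf_neq0 //; ring.
have dexi : xi ^+ 2 - 1 = de ^+ 2 by rewrite xiE /de; field.
have [plus minus] : (chebv k).1 + de * (chebv k).2 = ((1 + s) / (1 - s)) ^+ k /\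
    (chebv k).1 - de * (chebv k).2 = ((1 - s) / (1 + s)) ^+ k.
  elim: k => [|k []] /=; first by rewrite mulr0 addr0 subr0 !expr0.
  case: (chebv k) => t u /= h1 h2; rewrite [X in _ = X /\ _]exprS [X in _ /\ _ = X]exprS -h1 -h2.
  have -> : (1 + s) / (1 - s) = xi + de.
    by rewrite xiE /de; field; rewrite s12 gt_eqF.
  have -> : (1 - s) / (1 + s) = xi - de.
    by rewrite xiE /de; field; rewrite s12 gt_eqF.
  rewrite -(opprB (xi ^+ 2)) dexi; split; ring.
have : 0 <= ((1 - s) / (1 + s)) ^+ k by rewrite exprn_ge0 // divr_ge0 // ltW.
have : (1 - s)^-1 ^+ k <= ((1 + s) / (1 - s)) ^+ k.
  rewrite lerXn2r ?nnegrE ?invr_ge0 ?(divr_ge0 (ltW s2)) ?(ltW s1) //.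
  by rewrite ler_peMl ?invr_ge0 ?(ltW s1) // lerDl ltW.
rewrite -minus -plus; lra.
Qed.

Hypothesis w0_norm : enorm w0 <= 1.

(** Duality with [x = T^-1 e], [e] the last basis vector. Since [y] and [g] vanish in the last
    entry, pairing with [x] kills [T y] and [T g]; so [T_n(xi) sg <x,e> = <x, T_n(X) w0>], where the
    right side is at most [1/mu] and [<x,e> >= 1/b]. *)
Lemma residual_last (y : 'cV[R]_n.+1) (sg : R) :
  y ord_max 0 = 0 -> T *m y = w0 - sg *: delta_mx ord_max 0 ->
  `|sg| <= 2 * (b / mu) * (1 - s) ^+ n.
Proof.
move=> y0 Ty; pose e : 'cV[R]_n.+1 := delta_mx ord_max 0.
have dot_e x : dot e x = x ord_max 0.
  rewrite /e dotE (bigD1 ord_max) //= big1 ?mxE ?eqxx ?mul1r ?addr0 //.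
  by move=> i ni; rewrite mxE (negPf ni) mul0r.
have ee : dot e e = 1 by rewrite dot_e /e mxE !eqxx.
have ne : enorm e = 1 by rewrite /enorm ee sqrtr1.
pose x := invmx T *m e.
have Tx : T *m x = e by exact: mulKB mu_gt0 T_lo _.
have xe : b^-1 <= dot x e.
  rewrite -div1r ler_pdivrMr // mulrC -ee (dotC x).
  exact: (inv_form_lo T_sym mu_gt0 T_lo).
have nx : enorm x <= mu^-1 by have := inv_enorm mu_gt0 T_lo e; rewrite ne div1r.
have [g [_ [cE _ gs _ _]]] := cheb_krylov n.
have key : (chebv n).1 * (sg * dot x e) = dot x (cheb n).1.
  have w0E : w0 = T *m y + sg *: e by rewrite Ty subrK.
  rewrite cE !dot_lin -(dot_sym _ _ T_sym) Tx dot_e (gs ord_max) // subr0; congr (_ * _).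
  by rewrite w0E !dot_lin -(dot_sym _ _ T_sym) Tx dot_e y0 add0r.
have s1 : 0 < 1 - s by rewrite subr_gt0.
have c_gt0 : 0 < (1 - s)^-1 ^+ n by rewrite exprn_gt0 // invr_gt0.
have h1 : `|dot x (cheb n).1| <= mu^-1.
  apply: le_trans (dot_le _ _) _; rewrite -[leRHS]mulr1.
  by rewrite ler_pM ?enorm_ge0 // (le_trans (cheb_le n)).
have xe0 : 0 < dot x e by apply: lt_le_trans xe; rewrite invr_gt0.
have tg : 0 < (chebv n).1 by apply: lt_le_trans (chebv_ge n); rewrite divr_gt0.
rewrite -key !normrM (gtr0_norm xe0) (gtr0_norm tg) in h1.
have h2 : (1 - s)^-1 ^+ n / 2 * (`|sg| / b) <= mu^-1.
  apply: le_trans h1; apply: ler_pM.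
  - by rewrite divr_ge0 // ltW.
  - by rewrite divr_ge0 // ltW.
  - exact: chebv_ge.
  - by rewrite ler_wpM2l.
have : `|sg| = (1 - s)^-1 ^+ n / 2 * (`|sg| / b) * (2 * b * (1 - s) ^+ n).
  rewrite exprVn; field; rewrite gt_eqF //= expf_neq0 // gt_eqF //.
move=> ->; apply: le_trans (_ : mu^-1 * (2 * b * (1 - s) ^+ n) <= _).
  by rewrite ler_wpM2r // !mulr_ge0 ?exprn_ge0 // ltW.
by rewrite le_eqVlt; apply/orP; left; apply/eqP; ring.
Qed.

End Chebyshev.

(** * Tridiagonal matrices *)

Section Tridiagonal.
Context {R : realType}.
Implicit Types (al be X : nat -> R) (k : nat).

Definition tri al be k : 'M[R]_k := \matrix_(i < k, j < k)
  (if i == j then al i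
   else if (j == i.+1 :> nat) || (i == j.+1 :> nat) then be (minn i j).+1 else 0).

(** Extension by zero lets one row formula serve the last row as well; the first row is covered by
    [be 0 = 0]. *)
Definition ext k (x : 'cV[R]_k) (i : nat) : R :=
  if insub i is Some i' then x i' 0 else 0.

Lemma ext_ord k (x : 'cV[R]_k) (i : 'I_k) : ext x i = x i 0.
Proof. by rewrite /ext valK. Qed.

Lemma ext_out k (x : 'cV[R]_k) i : (k <= i)%N -> ext x i = 0.
Proof. by move=> ki; rewrite /ext insubF // ltnNge ki. Qed.

Lemma sum_pick k (x : 'cV[R]_k) c :
  \sum_(j < k) (j == c :> nat)%:R * x j 0 = ext x c.
Proof.
have [ck|kc] := ltnP c k; last first.
  rewrite ext_out // big1 // => j _; case: eqP => [jc|]; last by rewrite mul0r.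
  by have := ltn_ord j; rewrite jc ltnNge kc.
rewrite (bigD1 (Ordinal ck)) //= eqxx mul1r big1 => [|j jc].
  by rewrite addr0 -(ext_ord x (Ordinal ck)).
by rewrite -val_eqE /= in jc; rewrite (negPf jc) mul0r.
Qed.

Lemma tri_mulE al be k (x : 'cV[R]_k) (i : 'I_k) : be 0%N = 0 ->
  (tri al be k *m x) i 0 =
    be i * ext x i.-1 + al i * ext x i + be i.+1 * ext x i.+1.
Proof.
move=> b0; rewrite mxE -!sum_pick !mulr_sumr -!big_split /=; apply: eq_bigr => j _.
rewrite mxE !mulrA -!mulrDl; congr (_ * _).
have [<-|nij] := eqVneq i j.
  rewrite eqxx (_ : (i == i.+1 :> nat) = false) ?mulr1 ?mulr0 ?addr0; last by apply/eqP; lia.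
  (* [i = i.-1] happens only at 0, where the coefficient [be 0] vanishes. *)
  have [i0|] := eqVneq (i : nat) i.-1; last by rewrite mulr0 add0r.
  by rewrite (_ : i = 0%N :> nat) ?b0 ?mul0r ?add0r //; lia.
have nji : (j == i :> nat) = false by apply/negbTE; rewrite eq_sym val_eqE.
rewrite nji mulr0 addr0.
have [ji|jni] := eqVneq (j : nat) i.+1.
  rewrite /= (_ : minn i j = i); last by apply/minn_idPl; lia.
  by rewrite (_ : (j == i.-1 :> nat) = false) ?mulr0 ?add0r ?mulr1 //; apply/eqP; lia.
rewrite /= mulr0 addr0.
have [ij|inj] := eqVneq (i : nat) j.+1.
  rewrite (_ : minn i j = j); last by apply/minn_idPr; lia.
  by rewrite -ij (_ : (j == i.-1 :> nat)) ?mulr1 //; apply/eqP; lia.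
have [ji|_] := eqVneq (j : nat) i.-1; last by rewrite mulr0.
by rewrite (_ : i = 0%N :> nat) ?b0 ?mul0r //; move/eqP: nji; lia.
Qed.

Lemma tri_sym al be k : (tri al be k)^T = tri al be k.
Proof.
by apply/matrixP => i j; rewrite !mxE eq_sym orbC minnC; case: eqP => // ->.
Qed.

Lemma tri_hess al be k (i j : 'I_k) : (j.+1 < i)%N -> tri al be k i j = 0.
Proof.
move=> ji; rewrite mxE -val_eqE /= ifF; last by apply/eqP; lia.
by rewrite ifF //; apply/negbTE; rewrite negb_or; apply/andP; split; apply/eqP; lia.
Qed.

Definition tri_row al be X i := be i * X i.-1 + al i * X i + be i.+1 * X i.+1.

Lemma tri_dotE al be k (x : 'cV[R]_k) : be 0%N = 0 ->
  dot x (tri al be k *m x) = \sum_(i < k) ext x i * tri_row al be (ext x) i.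
Proof.
move=> b0; rewrite dotE; apply: eq_bigr => i _.
by rewrite tri_mulE // -ext_ord.
Qed.

(** The [L D L^T] factorisation as a sum of squares. [X] is a free sequence and the boundary terms
    in [X k.+1] are kept, so that the induction on [k] closes. *)
Lemma tri_squares al be X k : be 0%N = 0 ->
  (forall j, (j <= k)%N -> pivot al be j != 0) ->
  \sum_(i < k.+1) X i * tri_row al be X i =
  \sum_(i < k.+1) pivot al be i * (X i + be i.+1 / pivot al be i * X i.+1) ^+ 2
    - be k.+1 * X k * X k.+1 - be k.+1 ^+ 2 / pivot al be k * X k.+1 ^+ 2.
Proof.
move=> b0; elim: k => [|k ih] dn.
  by rewrite !big_ord1 /tri_row b0 /=; field; apply: (dn 0%N).
rewrite big_ord_recr ih => [|j jk]; last by apply: dn; apply: ltnW.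
rewrite [in RHS]big_ord_recr /=.
have dk := dn _ (leqnSn k); have dk1 := dn _ (leqnn k.+1).
have aE : al k.+1 = pivot al be k.+1 + be k.+1 ^+ 2 / pivot al be k.
  by rewrite /= subrK.
have -> : tri_row al be X k.+1 = be k.+1 * X k + (pivot al be k.+1
    + be k.+1 ^+ 2 / pivot al be k) * X k.+1 + be k.+2 * X k.+2.
  by rewrite -aE.
rewrite -/(pivot al be k.+1); move: (pivot al be k.+1) dk1 => D D0.
by field; rewrite dk D0.
Qed.

Section Form.
Variables (al be : nat -> R) (k : nat).
Hypothesis be0 : be 0%N = 0.
Hypothesis piv : forall j, (j < k)%N -> 0 < pivot al be j.

Lemma tri_sum_ge0 X : X k = 0 -> 0 <= \sum_(i < k) X i * tri_row al be X i.
Proof.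
case: k piv => [|k'] pv Xk; first by rewrite big_ord0.
rewrite tri_squares // => [|j jk]; last by rewrite gt_eqF // pv.
rewrite Xk expr0n /= !mulr0 !subr0 sumr_ge0 // => i _.
by rewrite mulr_ge0 ?sqr_ge0 // ltW // pv.
Qed.

Lemma tri_ge0 (x : 'cV[R]_k) : 0 <= dot x (tri al be k *m x).
Proof. by rewrite tri_dotE // tri_sum_ge0 // ext_out. Qed.

(* Flipping the signs of every other coordinate turns [T] into [2 diag T - T]. *)
Lemma tri_le c (x : 'cV[R]_k) : (forall j, (j < k)%N -> al j <= c) ->
  dot x (tri al be k *m x) <= 2 * c * dot x x.
Proof.
move=> alc; rewrite tri_dotE // dotE mulr_sumr.
pose X := ext x; pose Y i := (-1) ^+ i * X i.
have Y0 : 0 <= \sum_(i < k) Y i * tri_row al be Y i.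
  by apply: tri_sum_ge0; rewrite /Y /X ext_out ?mulr0.
rewrite -(lerD2r (\sum_(i < k) Y i * tri_row al be Y i)) -big_split /=.
apply: le_trans (_ : \sum_(i < k) 2 * c * (x i 0 * x i 0) <= _); last by rewrite lerDl.
apply: ler_sum => i _; rewrite -ext_ord -/X.
have -> : X i * tri_row al be X i + Y i * tri_row al be Y i = 2 * al i * (X i * X i).
  have sq j : (-1) ^+ j * (-1) ^+ j = 1 :> R by rewrite -exprMn mulrNN mulr1 expr1n.
  rewrite /tri_row /Y; case: (i : nat) => [|j] /=.
    by rewrite be0 expr0 expr1; ring.
  rewrite !exprS; have := sq j; move: ((-1) ^+ j) => s hs.
  transitivity (X j.+1 * (be j.+1 * X j + al j.+1 * X j.+1 + be j.+2 * X j.+2)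
    + (s * s) * X j.+1 * (al j.+1 * X j.+1 - be j.+1 * X j - be j.+2 * X j.+2)).
    ring.
  by rewrite hs; ring.
by rewrite ler_wpM2r -?expr2 ?sqr_ge0 // ler_wpM2l // alc.
Qed.

End Form.

Lemma tri_shift al be k mu (x : 'cV[R]_k) :
  tri al be k *m x = tri (fun i => al i - mu) be k *m x + mu *: x.
Proof.
rewrite -mul_scalar_mx -mulmxDl; congr (_ *m _); apply/matrixP => i j.
by rewrite !mxE; case: eqP => _; rewrite ?mulr1n ?mulr0n ?subrK ?addr0.
Qed.

(** Forward elimination: [D L^T y = L^-1 e_1], read in the last row. *)
Lemma tri_solve_last al be k (y : 'cV[R]_k.+1) : be 0%N = 0 ->
  (forall j, (j < k)%N -> pivot al be j != 0) ->
  tri al be k.+1 *m y = \col_(i < k.+1) (i == 0 :> nat)%:R ->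
  pivot al be k * y ord_max 0 = scale al be k.
Proof.
move=> b0 dn Ty.
have row i : (i < k.+1)%N -> tri_row al be (ext y) i = (i == 0%N)%:R.
  move=> ik; have := congr1 (fun v : 'cV_k.+1 => v (Ordinal ik) 0) Ty.
  by rewrite /= tri_mulE // mxE.
have key i : (i <= k)%N ->
    pivot al be i * ext y i + be i.+1 * ext y i.+1 = scale al be i.
  elim: i => [|i ih] ik.
    by have := row 0%N isT; rewrite /tri_row b0 mul0r add0r.
  have di := dn i ik; have r := row i.+1 ik.
  rewrite /tri_row /= in r; rewrite /= -(ih (ltnW ik)).
  have -> : (al i.+1 - be i.+1 ^+ 2 / pivot al be i) * ext y i.+1 + be i.+2 * ext y i.+2
    = (be i.+1 * ext y i + al i.+1 * ext y i.+1 + be i.+2 * ext y i.+2)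
      - be i.+1 / pivot al be i * (pivot al be i * ext y i + be i.+1 * ext y i.+1).
    by field.
  by rewrite r sub0r mulNr.
have := key k (leqnn _); rewrite (ext_out _ (leqnn _)) mulr0 addr0.
by rewrite -(ext_ord y ord_max).
Qed.

End Tridiagonal.

(** * Convergence of a perturbed run *)

Section Convergence.
Context {R : realType} {n : nat}.
Variables (H : 'M[R]_n) (a La dl : R) (p q w : nat -> 'cV[R]_n) (al be : nat -> R).
Hypothesis H_sym : H^T = H.
Hypothesis a_gt0 : 0 < a.
Hypothesis a_le_La : a <= La.
Hypothesis H_lo : forall x, a * dot x x <= dot x (H *m x).
Hypothesis H_up : forall x, dot x (H *m x) <= La * dot x x.
Hypothesis dl_ge0 : 0 <= dl.
Hypothesis be0 : be 0%N = 0.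

Let kappa := La / a.
Let K := invmx H.

Definition is_run N := 
  [/\ forall i, (i < N)%N -> dot (p i) (q i) = 1,
      forall i, (i < N)%N -> enorm (q i - p i) <= dl * enorm (p i),
      forall i, (i < N)%N -> H *m q i = be i *: p i.-1 + al i *: p i + w i,
      forall i, (i.+1 < N)%N -> w i = be i.+1 *: p i.+1 /\ be i.+1 != 0 &
      forall i, (i < N)%N -> dot (q i) (w i) = 0].

(** [4 * kappa] is the [rho] of the perturbation analysis with coercivity constant [m = a / 2]. *)
Definition small_error N := 2048 * N%:R ^+ 3 * (4 * kappa) ^+ 4 * dl <= 1.

Let La_gt0 : 0 < La. Proof. exact: lt_le_trans a_le_La. Qed.
Let kappa_ge1 : 1 <= kappa. Proof. by rewrite /kappa ler_pdivlMr // mul1r. Qed.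

Let mu := a / 2.
Let m_gt0 : 0 < a / 2. Proof. by rewrite divr_gt0. Qed.
Let m_le : a / 2 <= La. Proof. by have := a_le_La; have := a_gt0; lra. Qed.
Let rhoE : 4 * kappa = 2 * La / (a / 2).
Proof. by rewrite /kappa; field; rewrite gt_eqF. Qed.

Lemma small_error_le M N : (M <= N)%N -> small_error N -> small_error M.
Proof.
move=> MN; apply: le_trans; rewrite ler_wpM2r //.
have k0 : 0 <= (4 * kappa) ^+ 4 by rewrite exprn_ge0 // mulr_ge0 // (le_trans _ kappa_ge1).
rewrite ler_wpM2r ?k0 // ler_wpM2l ?ler0n // lerXn2r ?nnegrE ?ler0n //.
by rewrite ler_nat.
Qed.

Let B := H - mu%:M.
Implicit Types x : 'cV[R]_n.

Let BE x : B *m x = H *m x - mu *: x.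
Proof. by rewrite /B mulmxBl mul_scalar_mx. Qed.
Let B_sym : B^T = B.
Proof. by rewrite /B raddfB /= tr_scalar_mx H_sym. Qed.
Let B_lo x : a / 2 * dot x x <= dot x (B *m x).
Proof. by rewrite BE !dot_lin; have := H_lo x; rewrite /mu; lra. Qed.
Let B_up x : dot x (B *m x) <= La * dot x x.
Proof.
rewrite BE !dot_lin; have := H_up x; have := mulr_ge0 (ltW m_gt0) (dot_ge0 x).
rewrite /mu; lra.
Qed.

Section Fixed.
Variable N : nat.
Hypothesis N_gt0 : (0 < N)%N.
Hypothesis run : is_run N.
Hypothesis sm : small_error N.

Let al' i := al i - mu.

Let shift_run i : (i < N)%N ->
  B *m q i + mu *: (q i - p i) = be i *: p i.-1 + al' i *: p i + w i.
Proof.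
case: run => _ _ h _ _ iN; rewrite BE h //.
by apply/matrixP => u v; rewrite /al' !mxE; ring.
Qed.

Lemma shift_pivot i : (i < N)%N -> 0 < pivot al' be i.
Proof.
move=> iN; case: run => h1 h2 h3 h4 h5.
apply: lt_le_trans (pivot_ge B_sym m_gt0 m_le B_lo B_up (ltW m_gt0) (lexx _) N_gt0
  dl_ge0 rhoE sm h1 h2 shift_run be0 h4 h5 iN).
by rewrite !divr_gt0.
Qed.

Lemma shift_al i : (i < N)%N -> al' i <= 20 * La.
Proof.
move=> iN; case: run => h1 h2 h3 h4 h5.
apply: (al_up m_gt0 m_le B_up (ltW m_gt0) (lexx _) N_gt0
  dl_ge0 rhoE sm h1 h2 shift_run be0 h4 h5 iN) => j ji.
by apply: shift_pivot; apply: leq_ltn_trans iN.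
Qed.

Lemma tri_lo k (x : 'cV[R]_k) : (k <= N)%N ->
  mu * dot x x <= dot x (tri al be k *m x).
Proof.
move=> kN; rewrite (tri_shift _ _ mu) !dot_lin lerDr; apply: tri_ge0 => // j jk.
by apply: shift_pivot; apply: leq_trans kN.
Qed.

Lemma tri_up k (x : 'cV[R]_k) : (k <= N)%N ->
  dot x (tri al be k *m x) <= 41 * La * dot x x.
Proof.
move=> kN; rewrite (tri_shift _ _ mu) !dot_lin.
have := @tri_le _ al' be k be0 _ (20 * La) x.
have h1 j : (j < k)%N -> 0 < pivot al' be j.
  by move=> jk; apply: shift_pivot; apply: leq_trans kN.
have h2 j : (j < k)%N -> al' j <= 20 * La.
  by move=> jk; apply: shift_al; apply: leq_trans kN.
move=> /(_ h1 h2) h3; have h4 := ler_wpM2r (dot_ge0 x) m_le.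
rewrite /mu; lra.
Qed.

Lemma tri_unit k : (k <= N)%N -> tri al be k \in unitmx.
Proof. by move=> kN; apply: (coercive_unit m_gt0) => x; apply: tri_lo. Qed.

End Fixed.

Definition e1 k : 'cV[R]_k := \col_(i < k) (i == 0 :> nat)%:R.

(** [H Q = P T + w e^T] applied to [Y]. The subtracted term removes the part of the last [tri_row]
    that lies beyond the truncated matrix. *)
Lemma tri_comb N j (Y : nat -> R) : is_run N -> (j < N)%N ->
  \sum_(i < j.+1) Y i *: (H *m q i) =
  \sum_(i < j.+1) tri_row al be Y i *: p i - (be j.+1 * Y j.+1) *: p j + Y j *: w j.
Proof.
case=> _ _ h3 h4 _; elim: j => [|j ih] jN.
  rewrite !big_ord1 h3 // be0 /tri_row be0 /=.
  by apply/matrixP => u v; rewrite !mxE; ring.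
rewrite big_ord_recr ih ?(ltnW jN) // [in RHS]big_ord_recr /= h3 //=.
have [-> _] := h4 _ jN.
by apply/matrixP => u v; rewrite /tri_row !mxE /=; ring.
Qed.

Lemma lanczos_residual N j (y : 'cV[R]_j.+1) : is_run N -> (j < N)%N ->
  tri al be j.+1 *m y = e1 j.+1 ->
  H *m (\sum_(i < j.+1) y i 0 *: q i) = p 0%N + y ord_max 0 *: w j.
Proof.
move=> run jN Ty; rewrite mulmx_sumr.
under eq_bigr do rewrite -scalemxAr -ext_ord.
rewrite (tri_comb _ run jN) (ext_out _ (leqnn _)) mulr0 scale0r subr0.
rewrite -(ext_ord y ord_max) /=; congr (_ + _).
have row i : (i < j.+1)%N -> tri_row al be (ext y) i = (i == 0%N)%:R.
  move=> ij; have := congr1 (fun v : 'cV_j.+1 => v (Ordinal ij) 0) Ty.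
  by rewrite tri_mulE // mxE.
rewrite big_ord_recl /= row // scale1r big1 ?addr0 // => i _.
by rewrite row ?scale0r // ltnS ltn_ord.
Qed.

Lemma p_form_lo N : (0 < N)%N -> is_run N -> small_error N ->
  2^-1 / La <= dot (p 0%N) (K *m p 0%N).
Proof.
move=> N0 [h1 h2 _ _ _] sm.
have /andP[h _] := p_norm m_gt0 m_le N0 dl_ge0 rhoE sm h1 h2 N0.
rewrite ler_pdivrMr // mulrC (le_trans h) //.
exact: (inv_form_lo H_sym a_gt0 H_lo).
Qed.

(** Padding [y] with a zero gives [T_(t+2) y' = e_1 + be_(t+1) y_t e_last], the situation of
    [residual_last]. The factor is [164 kappa = 2 * 41 La / (a / 2)]. *)
Lemma residual_cheb t (y : 'cV[R]_t.+1) : is_run t.+2 -> small_error t.+2 ->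
  tri al be t.+1 *m y = e1 t.+1 ->
  `|be t.+1 * y ord_max 0| <= 164 * kappa * (1 - Num.sqrt (mu / (41 * La))) ^+ t.+1.
Proof.
move=> run sm Ty.
pose y' : 'cV[R]_t.+2 := \col_i ext y i.
have ext_y' i : ext y' i = ext y i.
  have [it|ti] := ltnP i t.+2; last by rewrite !ext_out // ltnW.
  by rewrite -[i]/(nat_of_ord (Ordinal it)) ext_ord mxE.
have Ty' : tri al be t.+2 *m y' =
    e1 t.+2 - (- (be t.+1 * y ord_max 0)) *: delta_mx ord_max 0.
  apply/matrixP => i j; rewrite ord1 {j} tri_mulE // !ext_y' !mxE eqxx andbT.
  have [it|ti] := ltnP i t.+1.
    have := congr1 (fun v : 'cV_t.+1 => v (Ordinal it) 0) Ty.
    rewrite tri_mulE // mxE /= => ->.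
    rewrite (_ : (i == ord_max) = false) ?mulr0 ?subr0 //.
    by apply/negbTE; rewrite -val_eqE /=; lia.
  have -> : i = ord_max by apply: val_inj => /=; have := ltn_ord i; lia.
  rewrite /= eqxx (ext_out y (leqnn _)) (ext_out y (leqnSn _)) -(ext_ord y ord_max) /=; ring.
have ylast : y' ord_max 0 = 0 by rewrite mxE ext_out.
have mulb : mu < 41 * La by have := m_le; have := La_gt0; rewrite /mu; lra.
have w_supp : supp 1 (e1 t.+2) by move=> i i1; rewrite mxE; case: (i : nat) i1.
have w_norm : enorm (e1 t.+2) <= 1.
  rewrite /enorm dotE big_ord_recl /= !mxE /= mulr1 big1 ?addr0 ?sqrtr1 // => i _.
  by rewrite !mxE mul0r.
have N0 : (0 < t.+2)%N by [].
have := residual_last (tri_sym _ _ _) m_gt0 mulb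
  (fun x : 'cV[R]_t.+2 => tri_lo N0 run sm x (leqnn _))
  (fun x : 'cV[R]_t.+2 => tri_up N0 run sm x (leqnn _))
  (@tri_hess _ al be _) w_supp w_norm ylast Ty'.
rewrite normrN; congr (_ <= _); rewrite /kappa /mu; field; rewrite gt_eqF //.
Qed.

Let form v := dot v (K *m v).

(** The perturbation analysis with [mu = 0], where the final residual is [resid t.+1] up to sign.
    Its energy is at most the one after the first step, which already removes the fraction
    [36/100]. *)
Lemma residual_energy t (y : 'cV[R]_t.+1) : kappa <= 5/4 ->
  is_run t.+1 -> small_error t.+1 -> tri al be t.+1 *m y = e1 t.+1 ->
  form (y ord_max 0 *: w t) <= 64/100 * form (p 0%N).
Proof.
move=> k54 run sm Ty; have [h1 h2 h3 h4 h5] := run.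
have N0 : (0 < t.+1)%N by [].
(* The weaker constant [a / 2] keeps [rho = 4 * kappa], so that [small_error] applies unchanged. *)
have H_lo2 x : a / 2 * dot x x <= dot x (H *m x).
  apply: le_trans (H_lo x); rewrite ler_wpM2r ?dot_ge0 //.
  by have := a_gt0; lra.
have h3' i : (i < t.+1)%N -> H *m q i + 0 *: (q i - p i) = be i *: p i.-1 + al i *: p i + w i.
  by move=> it; rewrite scale0r addr0 h3.
have dge i : (i < t.+1)%N -> pivot al be i != 0.
  move=> it; rewrite gt_eqF //.
  apply: lt_le_trans (pivot_ge H_sym m_gt0 m_le H_lo2 H_up (lexx _) (ltW m_gt0) N0
    dl_ge0 rhoE sm h1 h2 h3' be0 h4 h5 it).
  by rewrite !divr_gt0.
have yE : y ord_max 0 = scale al be t / pivot al be t.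
  rewrite -(tri_solve_last be0 _ Ty) => [|j jt]; last by apply: dge; apply: ltnW.
  by rewrite mulrAC divff ?mul1r ?dge.
have E t' : (1 <= t')%N -> (t' <= t.+1)%N -> energy H p w al be t' <= energy H p w al be 1.
  by apply: (energy_le H_sym m_gt0 m_le H_lo2 H_up (lexx _) (ltW m_gt0) N0
    dl_ge0 rhoE sm h1 h2 h3' be0 h4 h5).
have := E t.+1 N0 (leqnn _).
rewrite (energy1 H_sym m_gt0 m_le H_lo2 H_up (lexx _) (ltW m_gt0) N0
    dl_ge0 rhoE sm h1 h2 h3' be0 h4 h5 erefl).
have -> : energy H p w al be t.+1 = form (y ord_max 0 *: w t).
  by rewrite /energy /resid yE /form !(scaleNr, mulmxN, dotNl, dotNr) opprK.
rewrite /energy /resid -/(form _) => /le_trans; apply.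
have al0 := al0_up m_gt0 m_le H_up N0
    dl_ge0 rhoE sm h1 h2 h3' be0 h5 erefl.
have p0up : form (p 0%N) <= 5/4 / a.
  apply: le_trans (inv_form_up a_gt0 H_lo _) _; rewrite ler_wpM2r ?invr_ge0 ?(ltW a_gt0) //.
  have /andP[_] := p_norm m_gt0 m_le N0 dl_ge0 rhoE sm h1 h2 N0.
  lra.
have al_gt0 : 0 < al 0%N.
  have := dge 0%N N0; have := pivot_ge H_sym m_gt0 m_le H_lo2 H_up (lexx _) (ltW m_gt0) N0
    dl_ge0 rhoE sm h1 h2 h3' be0 h4 h5 N0 => /= + _.
  by apply: lt_le_trans; rewrite !divr_gt0.
have f0 : 0 <= form (p 0%N) by apply: (inv_form_ge0 a_gt0 H_lo).
have Lk : La <= 5/4 * a by move: k54; rewrite /kappa ler_pdivrMr.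
suff : 36/100 * form (p 0%N) <= (al 0%N)^-1 by lra.
rewrite -[leRHS]div1r ler_pdivlMr //.
apply: le_trans (_ : 36/100 * (5/4 / a) * (5/4 * (5/4 * a)) <= _); last first.
  rewrite (_ : _ * _ = 36/100 * (125/64)); first by lra.
  by field; rewrite gt_eqF.
apply: ler_pM; rewrite ?mulr_ge0 ?(ltW al_gt0) //; first by rewrite ler_wpM2l.
by apply: le_trans al0 _; rewrite ler_wpM2l.
Qed.

(** The residual is [be_(t+1) y_t p_(t+1)]. The energies of [p_(t+1)] and [p_0] differ by a factor
    of at most [3 * kappa], which is below its own square. *)
Lemma residual_accel t (y : 'cV[R]_t.+1) eps : 0 < eps -> is_run t.+2 -> small_error t.+2 ->
  tri al be t.+1 *m y = e1 t.+1 ->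
  3 * kappa * (164 * kappa * (1 - Num.sqrt (mu / (41 * La))) ^+ t.+1) <= eps ->
  form (y ord_max 0 *: w t) <= eps ^+ 2 * form (p 0%N).
Proof.
move=> eps0 run sm Ty Heps; have [h1 h2 h3 h4 h5] := run.
have N0 : (0 < t.+2)%N by [].
have hs := residual_cheb run sm Ty.
set c := 164 * _ * _ in hs Heps; clearbody c.
have [wE _] := h4 t (leqnn _).
rewrite wE scalerA /form -scalemxAr !dot_lin mulrA -expr2.
have k0 : 0 < kappa by apply: lt_le_trans kappa_ge1.
have pt : dot (p t.+1) (K *m p t.+1) <= 3 / 2 / a.
  apply: le_trans (inv_form_up a_gt0 H_lo _) _; rewrite ler_wpM2r ?invr_ge0 ?(ltW a_gt0) //.
  have /andP[_] := p_norm m_gt0 m_le N0 dl_ge0 rhoE sm h1 h2 (leqnn t.+2).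
  lra.
have p0 := p_form_lo N0 run sm.
apply: le_trans (_ : c ^+ 2 * (3 / 2 / a) <= _).
  apply: ler_pM; rewrite ?sqr_ge0 //; first exact: (inv_form_ge0 a_gt0 H_lo).
  rewrite -real_normK ?num_real // mulrC lerXn2r ?nnegrE //.
  exact: le_trans hs.
apply: le_trans (ler_wpM2l (sqr_ge0 _) p0).
have c0 : 0 <= c by apply: le_trans hs.
have : (3 * kappa * c) ^+ 2 <= eps ^+ 2.
  have kc : 0 <= 3 * kappa * c by apply: mulr_ge0 => //; apply: mulr_ge0 => //; apply: ltW.
  by rewrite lerXn2r // nnegrE ltW.
move/(ler_wpM2r (_ : 0 <= 2^-1 / La)) => h.
have : 0 <= 2^-1 / La by rewrite divr_ge0 // ltW.
move/h; apply: le_trans.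
rewrite (_ : _ * (2^-1 / La) = 3 * kappa * (c ^+ 2 * (3 / 2 / a))); last first.
  by rewrite /kappa; field; rewrite !gt_eqF.
have : 0 <= c ^+ 2 * (3 / 2 / a) by rewrite mulr_ge0 ?sqr_ge0 // !divr_ge0 // ltW.
move=> x0; rewrite ler_peMl //; have := kappa_ge1; lra.
Qed.

End Convergence.

(** * The inexact preconditioned Lanczos procedure *)

Section Algorithm.
Context {R : realType} {n : nat}.
Variables (A : 'M[R]_n) (SolveM : 'cV[R]_n -> 'cV[R]_n) (b : 'cV[R]_n).

Let z := Num.sqrt (dot b (SolveM b)).

(** Indices start at 0: the sequences below at [i] are the procedure's quantities with index
    [i + 1], and are meaningful until the stop flag is set. *)
Definition ipl_state i := lanczos_iter A SolveM i
  (LState [::] [::] [::] 0 (z^-1 *: b) (z^-1 *: SolveM b) 0 false).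

Notation st := ipl_state.
Definition ipl_qu i := ls_qu (st i).
Definition ipl_qb i := ls_qb (st i).
Definition ipl_beta i := ls_b (st i).
Let u i := A *m ipl_qb i - ipl_beta i *: ls_qu_prev (st i).
Definition ipl_alpha i := dot (u i) (ipl_qb i).
Definition ipl_w i := u i - ipl_alpha i *: ipl_qu i.
Let be' i := Num.sqrt (dot (ipl_w i) (SolveM (ipl_w i))).

Lemma ipl_stateS i : ~~ ls_stop (st i) -> st i.+1 =
  if be' i == 0 then
    LState (rcons (ls_alpha (st i)) (ipl_alpha i)) (ls_beta (st i))
      (rcons (ls_qbar (st i)) (ipl_qb i)) (ls_qu_prev (st i)) (ipl_qu i) (ipl_qb i) (ipl_beta i)
      true
  else
    LState (rcons (ls_alpha (st i)) (ipl_alpha i)) (rcons (ls_beta (st i)) (be' i))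
      (rcons (ls_qbar (st i)) (ipl_qb i)) (ipl_qu i) ((be' i)^-1 *: ipl_w i)
      ((be' i)^-1 *: SolveM (ipl_w i)) (be' i) false.
Proof. by move=> h; rewrite /st /= /lanczos_step (negPf h). Qed.

Lemma ipl_state_stop i : ls_stop (st i) -> st i.+1 = st i.
Proof. by move=> h; rewrite /st /= /lanczos_step h. Qed.

Lemma ipl_runS i : ~~ ls_stop (st i.+1) -> ~~ ls_stop (st i) /\ be' i != 0.
Proof.
move=> h; have hi : ~~ ls_stop (st i).
  by apply: contra h => h; rewrite ipl_state_stop.
by move: h; rewrite ipl_stateS //; case: eqP.
Qed.

Lemma ipl_run_le i j : (i <= j)%N -> ~~ ls_stop (st j) -> ~~ ls_stop (st i).
Proof.
elim: j => [|j ih]; first by rewrite leqn0 => /eqP->.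
rewrite leq_eqVlt => /orP[/eqP->//|ij] /ipl_runS[h _].
exact: ih.
Qed.

Lemma ipl_next i : ~~ ls_stop (st i.+1) ->
  [/\ ipl_beta i.+1 = be' i, ipl_qu i.+1 = (be' i)^-1 *: ipl_w i,
      ipl_qb i.+1 = (be' i)^-1 *: SolveM (ipl_w i) & ls_qu_prev (st i.+1) = ipl_qu i].
Proof.
move=> h; have [hi bi] := ipl_runS h.
by rewrite /ipl_beta /ipl_qu /ipl_qb ipl_stateS // (negPf bi).
Qed.

Lemma ipl_prev i : ~~ ls_stop (st i) ->
  ipl_beta i *: ls_qu_prev (st i) = ipl_beta i *: ipl_qu i.-1.
Proof.
(* Initially [ls_qu_prev] is 0 while [ipl_qu 0.-1] is [ipl_qu 0]; both are multiplied by
   [ipl_beta 0 = 0]. *)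
case: i => [|i] h; first by rewrite /ipl_beta /= !scale0r.
by have [_ _ _ ->] := ipl_next h.
Qed.

Lemma ipl_lists i : ~~ ls_stop (st i) ->
  [/\ ls_alpha (st i) = mkseq ipl_alpha i, ls_qbar (st i) = mkseq ipl_qb i &
      ls_beta (st i) = mkseq (fun j => ipl_beta j.+1) i].
Proof.
elim: i => [|i ih] h //; have [hi bi] := ipl_runS h; have [a1 a2 a3] := ih hi.
have [bE _ _ _] := ipl_next h.
rewrite ipl_stateS // (negPf bi) /= a1 a2 a3 -bE.
by rewrite !mkseqS.
Qed.

(** [j] is the last iteration performed. A stopping iteration records its [alpha] and [qbar] but no
    [beta]; on either exit only the first [j] betas enter the matrix. *)
Lemma ipl_final t : (0 < t)%N -> exists j,
  [/\ (j < t)%N, ~~ ls_stop (st j),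
      ls_alpha (st t) = mkseq ipl_alpha j.+1 /\ ls_qbar (st t) = mkseq ipl_qb j.+1,
      forall i, (i < j)%N -> (ls_beta (st t))`_i = ipl_beta i.+1 &
      be' j = 0 \/ j.+1 = t /\ ~~ ls_stop (st t)].
Proof.
elim: t => [//|t ih] _.
have [s|ns] := boolP (ls_stop (st t)).
  case: t => [//|t] in ih s *.
  have [j [jt nj [aE qE] bE h]] := ih isT; rewrite ipl_state_stop //.
  exists j; split=> //; first exact: ltnW.
  by case: h => [|[_]]; [left | rewrite s].
have [a1 a2 a3] := ipl_lists ns.
exists t; split=> //.
- by rewrite ipl_stateS //; case: ifP => _ /=; rewrite a1 a2 !mkseqS.
- move=> i it; rewrite ipl_stateS //; case: ifP => _ /=; rewrite a3 ?nth_rcons ?nth_mkseq //.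
  by rewrite size_mkseq it.
- have [b0|bn] := eqVneq (be' t) 0; [by left|right; split=> //].
  by rewrite ipl_stateS // (negPf bn).
Qed.

(** The length of the list occurs in the type of the matrix; with arbitrary lists, [k] can be
    replaced by that length before the matrices are compared. *)
Lemma output_tri (al bl : seq R) (qs : seq 'cV[R]_n) k alf bef qf :
  size al = k ->
  (forall i, (i < k)%N -> al`_i = alf i) ->
  (forall i, (i.+1 < k)%N -> bl`_i = bef i.+1) ->
  (forall i, (i < k)%N -> qs`_i = qf i) ->
  let T : 'M[R]_(size al) := \matrix_(i < size al, j < size al)
      (if i == j then al`_i
       else if (j == i.+1 :> nat) || (i == j.+1 :> nat) then bl`_(minn i j)
       else 0) in
  let y := invmx T *m (\col_(i < size al) (i == 0 :> nat)%:R) in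
  \sum_(j < size al) y j 0 *: qs`_j =
  \sum_(j < k) (invmx (tri alf bef k) *m e1 k) j 0 *: qf j.
Proof.
move=> <- alE blE qsE T y.
have -> : tri alf bef (size al) = T.
  apply/matrixP => i j; rewrite !mxE alE //.
  case: eqP => // /eqP nij; case: ifP => // h; rewrite blE //.
  by have := ltn_ord i; have := ltn_ord j; case/orP: h => /eqP ->; lia.
by apply: eq_bigr => j _; rewrite qsE.
Qed.

Lemma ipl_tri t : (0 < t)%N -> exists j,
  [/\ (j < t)%N, ~~ ls_stop (st j),
      ipl A SolveM b t =
        z *: \sum_(i < j.+1) (invmx (tri ipl_alpha ipl_beta j.+1) *m e1 j.+1) i 0 *: ipl_qb i &
      be' j = 0 \/ j.+1 = t /\ ~~ ls_stop (st t)].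
Proof.
move=> t0; have [j [jt nj [aE qE] bE h]] := ipl_final t0.
exists j; split=> //; rewrite /ipl -/z -/(ipl_state t); congr (_ *: _).
apply: output_tri => [|i ij|i ij|i ij].
- by rewrite aE size_mkseq.
- by rewrite aE nth_mkseq.
- by rewrite bE.
- by rewrite qE nth_mkseq.
Qed.

Variables (M S : 'M[R]_n) (dl : R).
Hypothesis A_spd : spd A.
Hypothesis M_spd : spd M.
Hypothesis S_spd : spd S.
Hypothesis SS : S *m S = invmx M.
Hypothesis dl_ge0 : 0 <= dl.
Hypothesis dl_lt1 : dl < 1.
Hypothesis solve_ok : forall r,
  Bnorm M (SolveM r - invmx M *m r) <= dl * Bnorm M (invmx M *m r).
Implicit Types x r : 'cV[R]_n.

Let S_unit : S \in unitmx. Proof. exact: spd_unit. Qed.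
Let S_sym : S^T = S. Proof. by case: S_spd. Qed.
Let Si_sym : (invmx S)^T = invmx S. Proof. by rewrite trmx_inv S_sym. Qed.
Let SK x : S *m (invmx S *m x) = x.
Proof. by rewrite mulmxA mulmxV ?mul1mx. Qed.
Let KS x : invmx S *m (S *m x) = x.
Proof. by rewrite mulmxA mulVmx ?mul1mx. Qed.

Lemma Bnorm_sqrt x : Bnorm M x = enorm (invmx S *m x).
Proof.
rewrite /Bnorm /enorm (dot_sym _ _ Si_sym); congr (Num.sqrt (dot _ _)).
have M_unit := spd_unit M_spd.
have : S *m (S *m (M *m x)) = x by rewrite !mulmxA SS mulVmx ?mul1mx.
by move/(congr1 (fun v => invmx S *m (invmx S *m v))); rewrite !KS.
Qed.

(** After the change of variables by [S], the accuracy of the solver is exactly the relative bound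
    on [q - p]. *)
Lemma solve_enorm r : enorm (invmx S *m SolveM r - S *m r) <= dl * enorm (S *m r).
Proof.
have := solve_ok r; rewrite !Bnorm_sqrt mulmxBr -SS -!mulmxA KS.
by [].
Qed.

Lemma solve_dot_ge r : (1 - dl) * dot (S *m r) (S *m r) <= dot r (SolveM r).
Proof.
have -> : dot r (SolveM r) = dot (S *m r) (invmx S *m SolveM r).
  by rewrite (dot_sym _ _ S_sym) SK.
rewrite -(subrK (S *m r) (invmx S *m SolveM r)) dotDr.
have h1 := dot_le (S *m r) (invmx S *m SolveM r - S *m r).
have h2 := ler_wpM2l (enorm_ge0 (S *m r)) (solve_enorm r).
rewrite mulrCA -expr2 enorm_sqr in h2.
have := le_trans h1 h2; rewrite ler_norml => /andP[h3 _]; lra.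
Qed.

Lemma solve_dot_ge0 r : 0 <= dot r (SolveM r).
Proof.
apply: le_trans (solve_dot_ge r); rewrite mulr_ge0 ?dot_ge0 //.
by rewrite subr_ge0 ltW.
Qed.

(** Breakdown occurs only at a zero vector, so an early stop means a zero residual. The lower bound
    also excludes that [Num.sqrt] returned 0 for a negative argument. *)
Lemma solve_dot_eq0 r : Num.sqrt (dot r (SolveM r)) = 0 -> r = 0.
Proof.
move/eqP; rewrite sqrtr_eq0 => h0; have := le_trans (solve_dot_ge r) h0.
rewrite pmulr_rle0 ?subr_gt0 // => h.
have : dot (S *m r) (S *m r) == 0 by rewrite eq_le h dot_ge0.
by rewrite dot_eq0 => /eqP Sr; rewrite -(KS r) Sr mulmx0.
Qed.

Hypothesis b_neq0 : b != 0.

Let z_neq0 : z != 0.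
Proof. by apply: contra b_neq0 => /eqP /solve_dot_eq0 ->. Qed.

Let scaled_solve r c : c = Num.sqrt (dot r (SolveM r)) -> c != 0 ->
  dot (c^-1 *: r) (c^-1 *: SolveM r) = 1 /\
  enorm (invmx S *m (c^-1 *: SolveM r) - S *m (c^-1 *: r)) <=
    dl * enorm (S *m (c^-1 *: r)).
Proof.
move=> cE c0; split.
  rewrite !dot_lin mulrA -expr2 exprVn cE sqr_sqrtr ?solve_dot_ge0 // mulVf //.
  by apply: contra c0 => /eqP h; rewrite cE h sqrtr0.
rewrite -!scalemxAr -scalerBr !enormZ mulrCA ler_wpM2l //.
exact: solve_enorm.
Qed.

Lemma ipl_scaled i : ~~ ls_stop (st i) -> dot (ipl_qu i) (ipl_qb i) = 1 /\
  enorm (invmx S *m ipl_qb i - S *m ipl_qu i) <= dl * enorm (S *m ipl_qu i).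
Proof.
case: i => [|i] h; first by apply: scaled_solve.
have [hi bi] := ipl_runS h; have [_ -> -> _] := ipl_next h.
exact: scaled_solve.
Qed.

Lemma ipl_is_run N : ~~ ls_stop (st N) ->
  is_run (S *m A *m S) dl (fun i => S *m ipl_qu i) (fun i => invmx S *m ipl_qb i)
    (fun i => S *m ipl_w i) ipl_alpha ipl_beta N.+1.
Proof.
move=> nN; have ns i : (i < N.+1)%N -> ~~ ls_stop (st i).
  by rewrite ltnS => iN; apply: ipl_run_le nN.
split=> i iN.
- by rewrite (dot_sym _ _ S_sym) SK; have [] := ipl_scaled (ns i iN).
- by have [] := ipl_scaled (ns i iN).
- rewrite -!mulmxA SK /ipl_w /u (ipl_prev (ns i iN)) !scalemxAr -!mulmxDr.
  by congr (_ *m _); apply/matrixP => k l; rewrite !mxE; ring.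
- have h := ns _ iN; have [_ bi] := ipl_runS h; have [-> -> _ _] := ipl_next h.
  by split=> //; rewrite -scalemxAr scalerA divff // scale1r.
- rewrite (dot_sym _ _ Si_sym) KS /ipl_w dotC dotDl dotNl dotZl.
  by have [-> _] := ipl_scaled (ns i iN); rewrite mulr1 -/(ipl_alpha i) subrr.
Qed.

Lemma ipl_stop_w j : be' j = 0 -> ipl_w j = 0.
Proof. exact: solve_dot_eq0. Qed.

Let H := S *m A *m S.

(** Since [p_0 = S b / z], the error equals [z S H^-1 (H g - p_0)], and [S A S = H] turns its
    [A]-norm into an [H^-1]-form. *)
Lemma error_form g :
  Bnorm A (z *: (S *m g) - invmx A *m b) =
  `|z| * Num.sqrt (dot (H *m g - S *m ipl_qu 0) (invmx H *m (H *m g - S *m ipl_qu 0))).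
Proof.
have A_unit := spd_unit A_spd.
have H_unit : H \in unitmx by rewrite !unitmx_mul A_unit S_unit.
have HE v : S *m (A *m (S *m v)) = H *m v by rewrite /H !mulmxA.
have -> : z *: (S *m g) - invmx A *m b =
    z *: (S *m (invmx H *m (H *m g - S *m ipl_qu 0))).
  rewrite mulmxBr mulmxA mulVmx // mul1mx mulmxBr scalerBr; congr (_ - _).
  rewrite /ipl_qu /= -scalemxAr -!scalemxAr scalerA divff // scale1r.
  apply: (can_inj (mulKmx A_unit)); rewrite mulKVmx //.
  apply: (can_inj (mulKmx S_unit)).
  by rewrite HE mulKVmx.
rewrite /Bnorm -(scalemxAr z A) dotZl dotZr mulrA -expr2 sqrtrM ?sqr_ge0 // sqrtr_sqr.
congr (_ * Num.sqrt _); set v := H *m g - _.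
by rewrite (dot_sym _ _ S_sym) HE mulKVmx // dotC.
Qed.

Lemma solution_form :
  Bnorm A (invmx A *m b) = `|z| * Num.sqrt (dot (S *m ipl_qu 0) (invmx H *m (S *m ipl_qu 0))).
Proof.
have := error_form 0.
rewrite !mulmx0 scaler0 !sub0r mulmxN dotNl dotNr opprK => <-.
by rewrite /Bnorm !(mulmxN, dotNl, dotNr) opprK.
Qed.

End Algorithm.

(** * Choice of the parameters *)

Section Budgets.
Context {R : realType}.
Variables kappa eps : R.
Hypothesis kappa_ge1 : 1 <= kappa.
Hypothesis eps_gt0 : 0 < eps.
Hypothesis eps_lt1 : eps < 1.

Let kappa_gt0 : 0 < kappa. Proof. exact: lt_le_trans kappa_ge1. Qed.
Let L := ln (kappa / eps).
Let sk := Num.sqrt kappa.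

Let ratio_gt1 : 1 < kappa / eps.
Proof. by rewrite ltr_pdivlMr // mul1r (lt_le_trans eps_lt1). Qed.

Let L_gt0 : 0 < L. Proof. exact: ln_gt0. Qed.

Let sk_gt0 : 0 < sk. Proof. by rewrite sqrtr_gt0. Qed.
Let sk_sqr : sk ^+ 2 = kappa. Proof. by rewrite sqr_sqrtr // ltW. Qed.

(** As [sqrt 82 < 10], [380 * sk * L] steps give a decay of [(eps / kappa)^38]. Two factors pay for
    [kappa^2]; the other 36, each at most 4/5, pay for [492 = 3 * 164] because [(4/5)^4 <= 1/2] and
    [2^9 = 512]. *)
Lemma cheb_budget t : 5/4 <= kappa / eps -> 380 * sk * L <= t%:R ->
  3 * kappa * (164 * kappa * (1 - Num.sqrt (82 * kappa)^-1) ^+ t) <= eps.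
Proof.
move=> k54 tL; set s := Num.sqrt _.
have s0 : 0 <= s by apply: sqrtr_ge0.
have k82 : 0 < 82 * kappa by rewrite mulr_gt0 // ltr0n.
have s2 : s ^+ 2 = (82 * kappa)^-1 by rewrite sqr_sqrtr // invr_ge0 ltW.
have slo : (10 * sk)^-1 <= s.
  have c0 : 0 < 10 * sk by rewrite mulr_gt0.
  rewrite -ler_sqr ?nnegrE ?invr_ge0 ?(ltW c0) // s2 exprVn exprMn sk_sqr.
  rewrite lef_pV2 ?posrE // ?mulr_gt0 ?exprn_gt0 //.
  by rewrite ler_wpM2r ?(ltW kappa_gt0) //; lra.
have s1 : s <= 1.
  rewrite -ler_sqr ?nnegrE // s2 expr1n invf_le1 //.
  by have := kappa_ge1; lra.
have r0 : 0 < eps / kappa by rewrite divr_gt0.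
have decay : (1 - s) ^+ t <= (eps / kappa) ^+ 38.
  apply: le_trans (_ : expR (- s) ^+ t <= _).
    rewrite lerXn2r ?nnegrE ?subr_ge0 ?expR_ge0 //.
    exact: le_trans (expR_ge1Dx _).
  rewrite -expRM_natr.
  have -> : eps / kappa = expR (- L).
    by rewrite expRN /L lnK ?posrE ?divr_gt0 // invf_div.
  rewrite -expRM_natr ler_expR !mulNr lerN2.
  apply: le_trans (_ : (10 * sk)^-1 * (380 * sk * L) <= _).
    rewrite (_ : _ * (380 * sk * L) = L * 38) //; field.
    by rewrite gt_eqF.
  by apply: ler_pM; rewrite ?invr_ge0 ?mulr_ge0 ?ler0n // ltW.
have small : (eps / kappa) ^+ 36 <= 2^-1 ^+ 9.
  rewrite (_ : (eps / kappa) ^+ 36 = ((eps / kappa) ^+ 4) ^+ 9); last by rewrite -exprM.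
  have e45 : eps / kappa <= 4/5.
    have : 5/4 * eps <= kappa by rewrite -ler_pdivlMr.
    by rewrite ler_pdivrMr //; lra.
  have h0 : 0 <= eps / kappa by exact: ltW.
  have h1 : 0 <= (eps / kappa) ^+ 4 by rewrite exprn_ge0.
  rewrite lerXn2r ?nnegrE ?invr_ge0 //.
  apply: le_trans (_ : (4/5) ^+ 4 <= _); last by lra.
  by rewrite lerXn2r // nnegrE; lra.
apply: le_trans (_ : 492 * kappa ^+ 2 * (eps / kappa) ^+ 38 <= _).
  rewrite (_ : 3 * kappa * _ = 492 * kappa ^+ 2 * (1 - s) ^+ t); last by ring.
  apply: ler_wpM2l decay; apply: mulr_ge0; first exact: ler0n.
  exact: exprn_ge0 (ltW kappa_gt0).
rewrite (_ : 492 * _ * _ = 492 * (eps / kappa) ^+ 36 * eps * eps); last first.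
  rewrite (_ : (eps / kappa) ^+ 38 = (eps / kappa) ^+ 36 * (eps / kappa) ^+ 2); last first.
    by rewrite -exprD.
  move: ((eps / kappa) ^+ 36) => X; field.
  by rewrite gt_eqF.
have h : 492 * (eps / kappa) ^+ 36 <= 1.
  have := small; rewrite (_ : 2^-1 ^+ 9 = 512^-1 :> R); first by lra.
  by field.
have e2 := mulr_ge0 (ltW eps_gt0) (ltW eps_gt0).
have := ler_wpM2r e2 h; rewrite mulrA mul1r => /le_trans; apply.
by rewrite ler_piMr // ltW.
Qed.

(** For [n >= 2], [om <= 1/2] and [kappa], [L] are at most [1/om], so [t + 1 <= 512 / om^2]. The
    product costs [2^46 / om^10], and 60 exceeds [10 + 46]. *)
Lemma size_budget (n t : nat) dl : (1 < n)%N -> 0 <= dl ->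
  dl <= (eps / (kappa * n%:R)) ^+ 60 -> t%:R <= 380 * sk * L + 1 ->
  2048 * t.+1%:R ^+ 3 * (4 * kappa) ^+ 4 * dl <= 1.
Proof.
move=> n1 dl0 dlle tle; set om := eps / _ in dlle.
have n2 : 2 <= n%:R :> R by rewrite ler_nat.
have n0 : 0 < n%:R :> R by apply: lt_le_trans n2.
have kn : 2 * kappa <= kappa * n%:R by rewrite mulrC ler_wpM2l // ltW.
have kn0 : 0 < kappa * n%:R by rewrite mulr_gt0.
have om0 : 0 < om by rewrite divr_gt0.
have om2 : om <= 2^-1.
  rewrite ler_pdivrMr //; have := kappa_ge1; have := eps_lt1; lra.
have o2 : 0 <= 2 * om by apply: mulr_ge0 => //; apply: ltW.
have a1 : (2 * om) ^+ 46 <= 1 by apply: exprn_ile1; lra.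
have a2 : om ^+ 4 <= 1 by apply: exprn_ile1; lra.
have kom : kappa <= om^-1.
  rewrite /om invf_div ler_pdivlMr //.
  have h := mulr_ge0 (ltW kappa_gt0) (ltW (_ : 0 < 1 - eps)).
  have := h; rewrite subr_gt0 eps_lt1 => /(_ isT); have := kn; have := kappa_gt0; lra.
have keom : kappa / eps <= om^-1.
  rewrite /om invf_div ler_wpM2r ?invr_ge0 ?(ltW eps_gt0) //.
  by have := kn; have := kappa_gt0; lra.
have skk : sk <= kappa.
  rewrite -[leRHS]sk_sqr expr2 ler_peMr ?(ltW sk_gt0) //.
  by rewrite -[leLHS]sqrtr1 ler_sqrt ?(ltW kappa_gt0).
have LL : L <= om^-1 by apply: le_trans keom; apply/ltW/ln_sublinear/divr_gt0.
have oi0 : 0 <= om^-1 by rewrite invr_ge0 ltW.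
have oi1 : 1 <= om^-1 by apply: le_trans kom.
have skL : sk * L <= om^-1 * om^-1.
  by apply: ler_pM => //; [exact: ltW | exact: ltW | exact: le_trans kom].
have tb : t.+1%:R <= 512 * (om^-1 * om^-1).
  have : 1 * 1 <= om^-1 * om^-1 by apply: ler_pM.
  rewrite -natr1; move: tle; rewrite -mulrA; lra.
have h1 : t.+1%:R ^+ 3 <= (512 * (om^-1 * om^-1)) ^+ 3.
  have B0 := le_trans (ler0n R t.+1) tb.
  by rewrite lerXn2r ?nnegrE ?tb ?B0 ?ler0n.
have h2 : (4 * kappa) ^+ 4 <= (4 * om^-1) ^+ 4.
  rewrite lerXn2r // ?nnegrE ?mulr_ge0 // ?(ltW kappa_gt0) //.
  by rewrite ler_wpM2l.
have k4 : 0 <= (4 * kappa) ^+ 4 by rewrite exprn_ge0 // mulr_ge0 // ltW.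
have t3 : 0 <= t.+1%:R ^+ 3 :> R by rewrite exprn_ge0 // ler0n.
have x0 : 0 <= 2048 :> R by exact: ler0n.
have e1 := ler_wpM2l x0 h1.
have e2 := ler_pM (mulr_ge0 x0 t3) k4 e1 h2.
apply: le_trans (ler_pM (mulr_ge0 (mulr_ge0 x0 t3) k4) dl0 e2 dlle) _.
have -> : 2048 * (512 * (om^-1 * om^-1)) ^+ 3 * (4 * om^-1) ^+ 4 * om ^+ 60 =
    (2 * om) ^+ 46 * om ^+ 4.
  have -> : om ^+ 60 = om ^+ 10 * om ^+ 50 by rewrite -exprD.
  have -> : (2 * om) ^+ 46 * om ^+ 4 = 2 ^+ 46 * om ^+ 50.
    by rewrite exprMn -mulrA -exprD.
  move: (om ^+ 50) => X; field; rewrite gt_eqF //.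
by apply: mulr_ile1 => //; apply: exprn_ge0 => //; apply: ltW.
Qed.

End Budgets.

(** * Error bound for the output and proof of the theorem *)

Section Main.
Context {R : realType} {n : nat}.
Variables (A M S : 'M[R]_n) (b : 'cV[R]_n) (SolveM : 'cV[R]_n -> 'cV[R]_n) (dl : R).
Hypothesis A_spd : spd A.
Hypothesis M_spd : spd M.
Hypothesis S_spd : spd S.
Hypothesis SS : S *m S = invmx M.
Hypothesis dl_ge0 : 0 <= dl.
Hypothesis dl_lt1 : dl < 1.
Hypothesis solve_ok : forall r,
  Bnorm M (SolveM r - invmx M *m r) <= dl * Bnorm M (invmx M *m r).
Hypothesis b_neq0 : b != 0.

Let H := S *m A *m S.
Let La := opnorm H.
Let a := (opnorm (invmx H))^-1.

Let S_sym : S^T = S. Proof. by case: S_spd. Qed.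

Let H_spd : spd H.
Proof.
have [A_sym Ap] := A_spd.
split=> [|x x0]; first by rewrite /H !trmx_mul A_sym S_sym mulmxA.
rewrite /H -!mulmxA -(dot_sym _ _ S_sym); apply: Ap.
apply: contra x0 => /eqP Sx.
have := congr1 (mulmx (invmx S)) Sx.
by rewrite mulmxA mulVmx ?spd_unit // mul1mx mulmx0 => ->.
Qed.

Let H_sym : H^T = H. Proof. by case: H_spd. Qed.

Let inv_opnorm_gt0 : 0 < opnorm (invmx H).
Proof.
have h := opnorm_form_lo b H_sym (spd_unit H_spd) (spd_ge0 H_spd).
have bH : 0 < dot b (H *m b) by case: H_spd => _; apply.
rewrite -(pmulr_lgt0 _ bH); apply: lt_le_trans h.
by rewrite dot_gt0.
Qed.

Let a_gt0 : 0 < a. Proof. by rewrite invr_gt0. Qed.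

Let H_lo x : a * dot x x <= dot x (H *m x).
Proof.
have h := opnorm_form_lo x H_sym (spd_unit H_spd) (spd_ge0 H_spd).
by rewrite mulrC ler_pdivrMr // mulrC.
Qed.

Let H_up x : dot x (H *m x) <= La * dot x x.
Proof. exact: opnorm_form_up. Qed.

Let a_le_La : a <= La.
Proof.
have b0 : 0 < dot b b by rewrite dot_gt0.
by rewrite -(ler_pM2r b0) (le_trans (H_lo b)).
Qed.

Let condE : cond H = La / a.
Proof. by rewrite /cond /a invrK. Qed.

Lemma cond_ge1 : 1 <= cond H.
Proof. by rewrite condE ler_pdivlMr // mul1r. Qed.

Notation alpha := (ipl_alpha A SolveM b).
Notation beta := (ipl_beta A SolveM b).
Notation z := (Num.sqrt (dot b (SolveM b))).

Let q i := invmx S *m ipl_qb A SolveM b i.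

Lemma ipl_combination k (y : 'cV[R]_k) :
  \sum_(i < k) y i 0 *: ipl_qb A SolveM b i = S *m \sum_(i < k) y i 0 *: q i.
Proof.
rewrite mulmx_sumr; apply: eq_bigr => i _; rewrite -scalemxAr; congr (_ *: _).
by rewrite mulmxA mulmxV ?spd_unit // mul1mx.
Qed.

Lemma sqrt_le_scale (x y e : R) : 0 <= e -> x <= e ^+ 2 * y ->
  Num.sqrt x <= e * Num.sqrt y.
Proof.
move=> e0 xy; rewrite -{1}(ger0_norm e0) -sqrtr_sqr -sqrtrM ?sqr_ge0 //.
exact: ler_wsqrtr.
Qed.

Lemma ipl_beta0 : beta 0 = 0. Proof. by []. Qed.

Lemma ipl_error t eps : (0 < t)%N -> 0 < eps -> small_error a La dl t.+1 ->
  (La / a <= 5/4 /\ 64/100 <= eps ^+ 2 \/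
   3 * (La / a) * (164 * (La / a) * (1 - Num.sqrt (a / 2 / (41 * La))) ^+ t) <= eps) ->
  Bnorm A (ipl A SolveM b t - invmx A *m b) <= eps * Bnorm A (invmx A *m b).
Proof.
move=> t0 eps0 sm budget.
have [j [jt nj -> stop]] := ipl_tri A SolveM b t0.
have run := ipl_is_run M_spd S_spd SS dl_lt1 solve_ok b_neq0 nj.
have smj : small_error a La dl j.+1 by apply: (small_error_le a_gt0 a_le_La dl_ge0) sm; apply: ltnW.
have Ty := mulKVmx (tri_unit H_sym a_gt0 a_le_La H_lo H_up dl_ge0 ipl_beta0 (ltn0Sn j)
  run smj (leqnn _)) (e1 j.+1).
set y := invmx _ *m _ in Ty *; rewrite ipl_combination.
rewrite (error_form A_spd M_spd S_spd SS dl_lt1 solve_ok b_neq0).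
rewrite (solution_form A_spd M_spd S_spd SS dl_lt1 solve_ok b_neq0).
rewrite mulrCA ler_wpM2l ?normr_ge0 //; apply: sqrt_le_scale; first exact: ltW.
rewrite -/H (lanczos_residual ipl_beta0 run (leqnn _) Ty) addrAC subrr add0r.
(* An early stop has [w j = 0], so the output is exact. *)
case: stop => [s0|[jE nt]].
  rewrite (ipl_stop_w M_spd S_spd SS dl_lt1 solve_ok s0).
  rewrite mulmx0 scaler0 dot0l mulr_ge0 ?sqr_ge0 //.
  exact: (inv_form_ge0 a_gt0 H_lo).
case: budget => [[k54 e64]|budget].
  apply: le_trans (residual_energy H_sym a_gt0 a_le_La H_lo H_up dl_ge0 ipl_beta0
    k54 run smj Ty) _.
  by rewrite ler_wpM2r // (inv_form_ge0 a_gt0 H_lo).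
rewrite -jE in nt budget sm *.
have run' := ipl_is_run M_spd S_spd SS dl_lt1 solve_ok b_neq0 nt.
exact: (residual_accel H_sym a_gt0 a_le_La H_lo H_up dl_ge0 ipl_beta0 eps0 run' sm Ty budget).
Qed.

(** For [n = 1] the solver error need not be small, but [<q_0, w_0> = 0] with [q_0] nonzero forces
    [w_0 = 0]: the first iteration is exact and stops the loop. *)
Lemma ipl_exact1 t eps : n = 1%N -> (0 < t)%N -> 0 < eps ->
  Bnorm A (ipl A SolveM b t - invmx A *m b) <= eps * Bnorm A (invmx A *m b).
Proof.
move=> n1 t0 eps0.
have [j [jt nj -> _]] := ipl_tri A SolveM b t0.
have n0 := ipl_run_le (leq0n j) nj.
have run := ipl_is_run M_spd S_spd SS dl_lt1 solve_ok b_neq0 n0.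
have [h1 _ h3 _ h5] := run.
have dot1 (x y : 'cV[R]_n) : dot x y = 0 -> x != 0 -> y = 0.
  clear -n1; subst n; rewrite dotE big_ord1 => /eqP; rewrite mulf_eq0 => /orP[] /eqP xy x0.
    by case/eqP: x0; apply/matrixP => i k; rewrite !ord1 xy mxE.
  by apply/matrixP => i k; rewrite !ord1 xy mxE.
have q_neq0 : q 0%N != 0.
  apply/eqP => q0; have := h1 0%N isT.
  by rewrite -/(q 0%N) q0 dot0r => /eqP; rewrite eq_sym oner_eq0.
have w0 : S *m ipl_w A SolveM b 0 = 0.
  by apply: (dot1 (q 0%N)) q_neq0; apply: h5.
have wv0 : ipl_w A SolveM b 0 = 0.
  have := congr1 (mulmx (invmx S)) w0.
  by rewrite mulmxA mulVmx ?spd_unit // mul1mx mulmx0.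
have j0 : j = 0%N.
  case: j nj {jt} => // j nj.
  have [_] := ipl_runS (ipl_run_le (isT : (1 <= j.+1)%N) nj).
  by rewrite wv0 dot0l sqrtr0 eqxx.
subst j.
have al_gt0 : 0 < alpha 0.
  have := congr1 (dot (q 0%N)) (h3 0%N isT).
  rewrite w0 addr0 ipl_beta0 scale0r add0r dotZr (dotC _ (S *m _)) h1 // mulr1 => <-.
  by have [_ Hp] := H_spd; apply: Hp.
have T_unit : tri alpha beta 1 \in unitmx.
  apply: (coercive_unit al_gt0) => x.
  have -> : tri alpha beta 1 *m x = alpha 0 *: x; last by rewrite dotZr.
  by apply/matrixP => i k; rewrite !ord1 !mxE big_ord1 !mxE.
have Ty := mulKVmx T_unit (e1 1).
set y := invmx _ *m _ in Ty *; rewrite ipl_combination.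
rewrite (error_form A_spd M_spd S_spd SS dl_lt1 solve_ok b_neq0).
rewrite -/H (lanczos_residual ipl_beta0 run (leqnn _) Ty) w0 scaler0 addr0 subrr.
rewrite dot0l sqrtr0 mulr0 mulr_ge0 ?(ltW eps0) //.
exact: sqrtr_ge0.
Qed.

End Main.

Lemma ipl_zero (R : realType) n (A : 'M[R]_n) SolveM t :
  ipl A SolveM 0 t = 0.
Proof. by rewrite /ipl dot0l sqrtr0 scale0r. Qed.

Theorem theorem6p1 :
  exists (c C : Rdefinitions.R), 0 < c /\ 0 < C /\
  forall (n : nat) (A M S : 'M[Rdefinitions.R]_n) (b : 'cV[Rdefinitions.R]_n)
         (SolveM : 'cV[Rdefinitions.R]_n -> 'cV[Rdefinitions.R]_n) (eps eps0 : Rdefinitions.R),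
    spd A -> spd M ->
    (* S = M^{-1/2}: the symmetric positive definite square root of M^{-1} *)
    spd S -> S *m S = invmx M ->
    0 < eps < 1 -> 0 <= eps0 ->
    eps0 <= powR (eps / (cond (S *m A *m S) * n%:R)) c ->
    (forall r : 'cV[Rdefinitions.R]_n,
        Bnorm M (SolveM r - invmx M *m r) <= eps0 * Bnorm M (invmx M *m r)) ->
    let kappa := cond (S *m A *m S) in
    let t : nat := absz (Num.ceil (C * Num.sqrt kappa * ln (kappa / eps))) in
    Bnorm A (ipl A SolveM b t - invmx A *m b) <= eps * Bnorm A (invmx A *m b).
Proof.
(* The constants of [size_budget] and [cheb_budget]. *)
exists 60%:R, 380%:R; split; first by rewrite ltr0n.
split; first by rewrite ltr0n.
move=> n A M S b SolveM eps eps0 sA sM sS SS /andP[e0 e1] d0 dle sok.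
cbv zeta; set kappa := cond (S *m A *m S) in dle *; set t := absz _.
(* For [b = 0] the factor [z] is 0, hence so is the output. *)
have [b0|bn] := eqVneq b 0.
  by rewrite b0 ipl_zero mulmx0 subr0 /Bnorm !mulmx0 dot0r sqrtr0 mulr0.
have n0 : (0 < n)%N.
  apply: contraNT bn => nn; apply/eqP/matrixP => i.
  by have := leq_ltn_trans (leq0n i) (ltn_ord i); rewrite (negPf nn).
have k1 : 1 <= kappa by apply: (cond_ge1 sA sS bn).
have k0 : 0 < kappa by apply: lt_le_trans k1.
have nR : 1 <= n%:R :> Rdefinitions.R by rewrite ler1n.
have kn0 : 0 < kappa * n%:R by apply: mulr_gt0 => //; apply: lt_le_trans nR.
have om0 : 0 <= eps / (kappa * n%:R) by apply: divr_ge0; apply: ltW.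
rewrite powR_mulrn // in dle.
have om1 : eps / (kappa * n%:R) < 1.
  rewrite ltr_pdivrMr // mul1r (lt_le_trans e1) //.
  by rewrite -[leLHS]mul1r ler_pM.
have d1 : eps0 < 1 by apply: le_lt_trans dle _; rewrite exprn_ilt1.
have L0 : 0 < ln (kappa / eps).
  by apply: ln_gt0; rewrite ltr_pdivlMr // mul1r (lt_le_trans e1).
set X := 380%:R * _ * _ in t *.
have X0 : 0 < X.
  by apply: mulr_gt0 L0; apply: mulr_gt0; [rewrite ltr0n | rewrite sqrtr_gt0].
have cX : 0 < Num.ceil X by rewrite ceil_gt0.
have tE : t%:R = (Num.ceil X)%:~R :> Rdefinitions.R.
  by rewrite /t natr_absz gtr0_norm.
have tlo : X <= t%:R by rewrite tE ceil_ge.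
have tup : t%:R <= X + 1.
  by have := ceilB1_lt X; rewrite rmorphB /= -tE lterBDr => /ltW.
have t0 : (0 < t)%N by rewrite -(ltr0n Rdefinitions.R) (lt_le_trans X0).
have [n1|n2] := leqP n 1.
  apply: (ipl_exact1 sA sM sS SS d1 sok bn) => //.
  by apply/eqP; rewrite eqn_leq n1.
have kE : opnorm (S *m A *m S) / (opnorm (invmx (S *m A *m S)))^-1 = kappa.
  by rewrite invrK.
apply: (ipl_error sA sM sS SS d0 d1 sok bn t0 e0).
  by rewrite /small_error kE; apply: (size_budget k1 e0 e1 n2 d0 dle tup).
rewrite kE; have [k54|k54] := leP (5/4) (kappa / eps).
  right; apply: le_trans (cheb_budget k1 e0 e1 k54 tlo); rewrite le_eqVlt; apply/orP; left.
  apply/eqP; congr (_ * (_ * (1 - Num.sqrt _) ^+ _)).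
  have i0 : opnorm (invmx (S *m A *m S)) != 0.
    by apply: contraTneq k0 => h; rewrite /kappa /cond h mulr0 ltxx.
  have l0 : opnorm (S *m A *m S) != 0.
    by apply: contraTneq k0 => h; rewrite /kappa /cond h mul0r ltxx.
  by rewrite /kappa /cond; field; rewrite i0 l0.
(* Together with [kappa >= 1] this forces [eps > 4/5], so the energy factor [64/100 = (4/5)^2]
   suffices. *)
left; have ke : kappa < 5/4 * eps by rewrite -ltr_pdivrMr.
split; first by lra.
have e45 : 4/5 <= eps by lra.
apply: le_trans (_ : (4/5) ^+ 2 <= _); first by lra.
by rewrite lerXn2r ?nnegrE //; lra.
Qed.
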